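(* Let $F$ be Lipschitz continuous, let $G$ be continuous with finite mean $1/\mu$, and let the arrival rate $\lambda\ge0$ and the initial data $\omega(0)$, $\bar Q(0)$, $\bar{\mathcal Z}(0)$ be as in the context. Then there exists a unique function $\bar X\in\mathbf C[0,\infty)$ (the space of continuous real functions on $[0,\infty)$) satisfying, for all $t\ge0$, $$\bar X(t)=\bar{\mathcal Z}(0)(C_t)+\bar Q(0)G^c(t)+\frac1\mu\int_0^tH_{t-s}\big((\bar X(t-s)-1)^+\big)\,dG_e(s)+\int_0^t(\bar X(t-s)-1)^+\,dG(s).$$
   Context: Notation: $C_x=(x,\infty)$, $a^+=\max(a,0)$, $a\wedge b=\min(a,b)$. $F$ and $G$ are distribution functions of nonnegative random variables, $F^c=1-F$, $G^c=1-G$, and $f=F'$ is the (a.e. defined) density of $F$. $G_e(x)=\mu\int_0^xG^c(y)\,dy$. Data: a number $\omega(0)\ge0$; a locally integrable function $\lambda\ge0$ on $[-\omega(0),\infty)$; a finite measure $\bar{\mathcal Z}(0)$ on $(0,\infty)$ without atoms. For $t\ge0$ and $x\in[0,t+\omega(0)]$ put $$F_t(x)=\int_0^xf(s)\lambda(t-s)\,ds,\qquad F_{d,t}(x)=\int_0^xF^c(s)\lambda(t-s)\,ds,\qquad N_{F,t}=F_{d,t}(t+\omega(0)),$$ $F_{d,t}^{-1}(y)=\inf\{x\ge0:F_{d,t}(x)\ge y\}$ for $y\in[0,N_{F,t}]$, and $$H_t(y)=\begin{cases}\lambda(t)-F_t(F_{d,t}^{-1}(y)),&0\le y<N_{F,t},\\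 \lambda(t)-F_t(F_{d,t}^{-1}(N_{F,t})),&y\ge N_{F,t}.\end{cases}$$ Initial conditions: $\bar Q(0)=\int_0^{\omega(0)}F^c(s)\lambda(-s)\,ds$ with $\omega(0)=F_{d,0}^{-1}(\bar Q(0))$; with $\bar Z(0)=\bar{\mathcal Z}(0)(C_0)$ and $\bar X(0)=\bar Q(0)+\bar Z(0)$, the non-idling constraints $\bar Q(0)=(\bar X(0)-1)^+$ and $\bar Z(0)=\bar X(0)\wedge1$ hold. *)

(* Defs.v *)
From HB Require Import structures.
From mathcomp Require Import all_boot all_order all_algebra.
From mathcomp Require Import all_classical all_reals all_analysis measurable_realfun.

Set Implicit Arguments.
Unset Strict Implicit.
Unset Printing Implicit Defensive.
Import Order.TTheory GRing.Theory Num.Theory.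
Import numFieldNormedType.Exports.

Local Open Scope classical_set_scope.
Local Open Scope ring_scope.

Section equilibrium.
Variable R : realType.
Local Notation leb := (@lebesgue_measure R).

(* As `[0, x] is empty for x < 0, Ge vanishes on the negative half-line, so
   its Lebesgue-Stieltjes measure is carried by [0, +oo[. *)
Definition Ge (mu : {posnum R}) (G : cumulativeBounded (0 : R) (1 : R))
    (x : R) : R :=
  mu%:num * \int[leb]_(y in `[0, x]) (1 - G y).

Variables (mu : {posnum R}) (G : cumulativeBounded (0 : R) (1 : R)).

Let Gc (y : R) : R := 1 - G y.

Let Gc_ge0 y : 0 <= Gc y.
Proof.
have h := cumulativey G.
rewrite subr_ge0 -[leRHS](cvg_lim (@Rhausdorff R) h); apply: limr_ge.
  by apply/cvg_ex; exists 1.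
near=> z; apply: (cumulative_is_nondecreasing G).
by near: z; apply: nbhs_pinfty_ge; rewrite num_real.
Unshelve. all: by end_near. Qed.

Let Gc_le1 y : Gc y <= 1.
Proof.
have h := cumulativeNy G.
rewrite lerBlDr lerDl -[leLHS](cvg_lim (@Rhausdorff R) h); apply: limr_le.
  by apply/cvg_ex; exists 0.
near=> z; apply: (cumulative_is_nondecreasing G).
by near: z; apply: nbhs_ninfty_le; rewrite num_real.
Unshelve. all: by end_near. Qed.

Let Gc_integrable (i : interval R) (a b : R) : i = `[a, b] \/ i = `]a, b] ->
  leb.-integrable [set` i] (EFin \o Gc).
Proof.
move=> ei; apply: measurable_bounded_integrable => //.
- by case: ei => ->; rewrite /= lebesgue_measure_itv/=;
    case: ifPn => // _; rewrite -EFinD ltry.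
- apply: measurable_funB => //.
  apply: nondecreasing_measurable => //.
  by move=> x y; exact: (cumulative_is_nondecreasing G).
- exists 1; split => // M M1 y _ /=.
  by rewrite ger0_norm// (le_trans (Gc_le1 y))// ltW.
Qed.

Let int_Gc_le (i : interval R) (a b : R) : i = `[a, b] \/ i = `]a, b] ->
  a <= b -> \int[leb]_(y in [set` i]) Gc y <= b - a.
Proof.
move=> ei ab.
have mi : leb [set` i] = (b - a)%:E.
  case: ei => ->; rewrite lebesgue_measure_itv/= lte_fin;
  by case: ltgtP ab => // -> _; rewrite subrr.
have h : \int[leb]_(y in [set` i]) Gc y <= \int[leb]_(y in [set` i]) (cst 1 y).
  apply: le_Rintegral => //.
  - exact: Gc_integrable ei.
  - apply: measurable_bounded_integrable => //.
    + by apply: (@le_lt_trans _ _ (b - a)%:E); [rewrite -mi|exact: ltry].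
    + by exists 1; split => // M M1 y _ /=; rewrite normr1 ltW.
have fmi : fine (leb [set` i]) <= b - a by rewrite mi.
by rewrite (le_trans h)// Rintegral_cst// mul1r; exact: fmi.
Qed.

Let Ge_incr x y : x <= y -> 0 <= Ge mu G y - Ge mu G x <= mu%:num * (y - x).
Proof.
move=> xy; have I0 (i : interval R) : 0 <= \int[leb]_(z in [set` i]) Gc z.
  by apply: Rintegral_ge0 => z _; exact: Gc_ge0.
rewrite /Ge -mulrBr pmulr_rge0// ler_pM2l//.
have [x0|x0] := ltP x 0.
  rewrite (_ : `[0, x]%classic = set0); last first.
    by rewrite set_itv_ge// bnd_simp -ltNge.
  rewrite Rintegral_set0 subr0 I0/=.
  have [y0|y0] := ltP y 0.
    by rewrite set_itv_ge ?Rintegral_set0 ?subr_ge0// bnd_simp -ltNge.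
  apply: (@le_trans _ _ (y - 0)); last by rewrite lerD2l lerN2 ltW.
  by apply: int_Gc_le => //; left.
rewrite (@Rintegral_itvB _ Gc); last 3 first.
- by apply: (@Gc_integrable _ 0 y); left.
- by rewrite bnd_simp.
- by rewrite bnd_simp.
by rewrite I0/=; apply: int_Gc_le => //; right.
Qed.

Let Ge_nd : nondecreasing (Ge mu G).
Proof. by move=> x y /Ge_incr/andP[]; rewrite subr_ge0. Qed.

Let Ge_rc : right_continuous (Ge mu G).
Proof.
move=> x; apply/cvgrPdist_le => /= e e0.
near=> y.
have xy : x <= y by near: y; exact: nbhs_right_ge.
have /andP[h0 h1] := Ge_incr xy.
rewrite distrC ger0_norm// (le_trans h1)// mulrC -ler_pdivlMr// lerBlDl.
near: y; apply: nbhs_right_le.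
by rewrite ltrDl divr_gt0.
Unshelve. all: by end_near. Qed.

HB.instance Definition _ := isCumulative.Build R _ R (Ge mu G) Ge_nd Ge_rc.

End equilibrium.

Section fluid_model.
Variable R : realType.
Local Notation leb := (@lebesgue_measure R).
Local Notation lsm := lebesgue_stieltjes_measure.

Section arrivals.
Variables (F lambda : R -> R) (omega0 : R).

(* The density f = F' is the total function derive1 F, which is F' at every point
   of differentiability of F, hence almost everywhere if F is Lipschitz; its
   arbitrary values elsewhere do not affect the integral. *)
Definition Ft (t x : R) : R :=
  \int[leb]_(s in `[0, x]) (derive1 F s * lambda (t - s)).

Definition Fd (t x : R) : R :=
  \int[leb]_(s in `[0, x]) ((1 - F s) * lambda (t - s)).

Definition NF (t : R) : R := Fd t (t + omega0).

(* Fd t is only meaningful on [0, t + omega0]: lambda is only given on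
   [- omega0, +oo[. *)
Definition Fdinv (t y : R) : R :=
  inf [set x | 0 <= x <= t + omega0 /\ y <= Fd t x].

Definition H (t y : R) : R :=
  if y < NF t then lambda t - Ft t (Fdinv t y)
  else lambda t - Ft t (Fdinv t (NF t)).

End arrivals.

Definition fluid_solution (F : R -> R) (G : cumulativeBounded (0 : R) (1 : R))
    (mu : {posnum R}) (lambda : R -> R) (omega0 Q0 : R)
    (Z0 : {finite_measure set (measurableTypeR R) -> \bar R})
    (X : R -> R) : Prop :=
  forall t, 0 <= t ->
    X t = fine (Z0 `]t, +oo[%classic) + Q0 * (1 - G t)
      + (mu%:num)^-1 * \int[lsm (Ge mu G)]_(s in `[0, t])
          H F lambda omega0 (t - s) (Num.max (X (t - s) - 1) 0)
      + \int[lsm G]_(s in `[0, t]) Num.max (X (t - s) - 1) 0.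

End fluid_model.

(* Main.v *)
Require Import Defs.
From HB Require Import structures.
From mathcomp Require Import all_boot all_order all_algebra.
From mathcomp Require Import all_classical all_reals all_analysis measurable_realfun.
From mathcomp Require Import ring lra.

Set Implicit Arguments.
Unset Strict Implicit.
Unset Printing Implicit Defensive.
Import Order.TTheory GRing.Theory Num.Theory.
Import numFieldNormedType.Exports.

Local Open Scope classical_set_scope.
Local Open Scope ring_scope.

(** For a Lipschitz [F] the equation is a Volterra equation whose nonlinearity
[K_u(y) = F_u(F_{d,u}^{-1}(y))] is only monotone and continuous in [y]: the
hazard rate [f / F^c] may be unbounded.  Since [dG_e = mu G^c ds], Fubini's
theorem turns the equation into [X = w - A + dG * (q + A)], where
[q = (X - 1)^+] and [A(t) = int_0^t K_u(q(u)) du].  For two solutions, the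
difference [beta] of the processes of entries into service satisfies
[zeta = beta - dG * beta], with [zeta] the difference of the [min(X, 1)].
Going back to the last time at which neither [q1 - q2] nor [zeta] is positive,
the monotonicity of [K] gives [beta(t) <= (dG * beta)(s)] for some [s <= t], and
convolution with [dG] is a contraction in an exponentially weighted norm because
[G(0) = 0].  This yields uniqueness, and it is stable under perturbations of
[K].  As [K_u(y) = int f(s) lambda(u - s) 1[F_{d,u}(s) < y] ds], replacing the
indicator by steep Lipschitz ramps gives equations solvable by Picard iteration;
by stability their solutions converge, and dominated convergence shows that the
limit is a solution. *)

(** * Delay Volterra equations with a monotone memory *)

(** No norm estimate on [X1 - X2] can close, because [K_u] has no modulus of continuity in [y]; only
    the sign of a difference is usable. Hence estimates go through one-sided order conditions. These
    carry a tolerance [rho]: two ramps of slopes at least [n + 1] become ordered once their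
    arguments are [1 / (n + 1)] apart, and [rho = 0] gives uniqueness for the true kernel. The
    stability constant depends only on the delay operator and the horizon, never on the slopes. The
    Picard rate does depend on them, so Picard iteration alone could not pass to the limit.

    The indicator formula for [K_u] and the dominated convergence rest on one fact: on a level set
    of [F_{d,u}] the product [f(s) lambda(u - s)] vanishes almost everywhere. There
    [F^c(s) lambda(u - s)] vanishes almost everywhere, being the density of [F_{d,u}], and where
    [F^c = 0] the distribution function [F] is at its maximum, so [f = 0]. Plateaus of [F_{d,u}],
    where the inverse jumps, are therefore invisible to [K_u]. *)

Lemma last_exit (R : realType) (h : R -> R) (t : R) :
  continuous h -> 0 <= t -> h 0 <= 0 ->
  exists s, [/\ 0 <= s, s <= t, h s <= 0 & forall r, s < r -> r <= t -> 0 < h r].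
Proof.
move=> ch t0 h0.
pose S := `[0, t]%classic `&` [set r | h r <= 0].
have cS : compact S.
  apply: (@subclosed_compact _ _ `[0, t]%classic).
  - apply: closedI; first exact: interval_closed.
    rewrite (_ : mkset _ = h @^-1` `]-oo, 0]%classic); last first.
      by apply/seteqP; split => r /=; rewrite in_itv.
    by apply: preimage_closed => // x _; exact: ch.
  - exact: segment_compact.
  - by move=> ? [].
have S0 : S !=set0 by exists 0; split => //=; rewrite in_itv/= lexx.
have := @compact_EVT_max _ R id S S0 cS.
case.
  by apply: continuous_subspaceT => x; exact: cvg_id.
move=> s /set_mem[/=]; rewrite in_itv/= => /andP[s0 st] hs smax.
exists s; split => // r sr rt; rewrite ltNge; apply/negP => hr.
have : r <= s.
  apply: smax; rewrite inE; split => //=.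
  by rewrite in_itv/= rt (le_trans s0)//= ltW.
by rewrite leNgt sr.
Qed.

(** Serves both the Picard iterates and the solutions for the ramps. As each [f n] is constant on
    the negative half-line, bounds on [[0, T]] also control neighbourhoods of 0 and of negative
    points, so the limit is continuous on the whole line. *)
Lemma locally_uniform_limit (R : realType) (f : nat -> R -> R) :
  (forall n, continuous (f n)) ->
  (forall n t, f n t = f n (Num.max t 0)) ->
  (forall T, 0 <= T -> exists e : nat -> R, e @ \oo --> 0 /\
     forall n m t, (n <= m)%N -> 0 <= t <= T -> `|f n t - f m t| <= e n) ->
  exists g : R -> R, [/\ continuous g, (forall t, g t = g (Num.max t 0)) &
    forall T, 0 <= T -> exists e : nat -> R, e @ \oo --> 0 /\
     forall n t, 0 <= t <= T -> `|f n t - g t| <= e n].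
Proof.
move=> cf fm fC.
have max0 (t : R) : 0 <= Num.max t 0 by rewrite le_max lexx orbT.
have cvt t : cvgn (f ^~ t).
  have [e [e0 he]] := fC _ (max0 t).
  apply/cauchy_cvgP; apply: cauchy_exP => eps eps0.
  have [N _ hN] := (cvgrPdist_lt _ _).1 e0 _ eps0.
  exists (f N t); exists N => // m Nm; rewrite -ball_normE/= fm [X in _ - X]fm.
  apply: (le_lt_trans (he N m _ Nm _)); first by rewrite max0 lexx.
  have := hN N (leqnn N); rewrite /= sub0r normrN => h.
  exact: (le_lt_trans (ler_norm _) h).
pose g t := limn (f ^~ t).
have gmax t : g t = g (Num.max t 0).
  by rewrite /g; congr (lim _); under eq_fun do rewrite fm.
have fg T : 0 <= T -> exists e : nat -> R, e @ \oo --> 0 /\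
     forall n t, 0 <= t <= T -> `|f n t - g t| <= e n.
  move=> T0; have [e [e0 he]] := fC _ T0; exists e; split => // n t tT.
  have h : `|f n t - f m t| @[m --> \oo] --> `|f n t - g t|.
    apply: cvg_norm; apply: cvgB; first exact: cvg_cst.
    exact: cvt.
  rewrite -(cvg_lim _ h)//; apply: limr_le; first by apply/cvg_ex; eexists; exact: h.
  by exists n => // m /= nm; apply: he.
exists g; split => // t.
have T0 : 0 <= Num.max t 0 + 1 by rewrite addr_ge0.
have [e [e0 he]] := fg _ T0.
apply/cvgrPdist_lt => eps eps0.
have e3 : 0 < eps / 3 by rewrite divr_gt0.
have [N _ hN] := (cvgrPdist_lt _ _).1 e0 _ e3.
have eN : e N < eps / 3.
  have := hN N (leqnn N); rewrite /= sub0r normrN => h.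
  exact: (le_lt_trans (ler_norm _) h).
have := (cvgrPdist_lt _ _).1 (cf N t) _ e3.
move=> ctN; near=> s.
have fN : `|f N t - f N s| < eps / 3 by near: s; exact: ctN.
have st : s <= t + 1.
  by apply: ltW; near: s; apply: lt_nbhsl; rewrite ltrDl.
have key r : r <= t + 1 -> `|f N r - g r| < eps / 3.
  move=> rt; rewrite fm gmax; apply: (le_lt_trans (he N _ _)) => //.
  rewrite max0/= ge_max T0 andbT (le_trans rt)// lerD2r.
  by rewrite le_max lexx.
have h1 := key s st.
have h2 : `|f N t - g t| < eps / 3 by apply: key; rewrite lerDl.
rewrite (_ : g t - g s = - (f N t - g t) + (f N t - f N s) + (f N s - g s)); last by ring.
apply: (le_lt_trans (ler_normD _ _)).
apply: (@le_lt_trans _ _ (`|f N t - g t| + `|f N t - f N s| + `|f N s - g s|)).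
  by rewrite lerD2r (le_trans (ler_normD _ _))// normrN.
lra.
Unshelve. all: by end_near. Qed.

(** * Stability of the Volterra equation under order conditions *)

Section Volterra.
Variable R : realType.
Implicit Types (p q w X Y A : R -> R) (s t u T M al : R).

Definition excess (x : R) : R := Num.max (x - 1) 0.

Lemma excessE x : x = excess x + Num.min x 1.
Proof.
rewrite /excess minEle maxEle; case: (leP x 1) => h; case: (leP (x - 1) 0) => h'; lra.
Qed.

Lemma excess_lip x y : `|excess x - excess y| <= `|x - y|.
Proof.
rewrite /excess !maxEle ler_norml.
case: (leP (x - 1) 0) => h; case: (leP (y - 1) 0) => h';
  have := ler_norm (x - y); have := ler_norm (- (x - y)); rewrite normrN;
  move=> h1 h2; apply/andP; split; lra.
Qed.

Lemma continuous_maxl (f : R -> R) (c : R) : continuous f ->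
  continuous (fun t => Num.max (f t) c).
Proof.
by move=> cf t; apply: (@continuous_comp _ _ _ f (fun x => Num.max x c));
  [exact: cf|apply: (@continuous_max _ _ id (cst c)) => //; exact: cst_continuous].
Qed.

Lemma continuous_excess X : continuous X -> continuous (fun t => excess (X t)).
Proof.
move=> cX; apply: continuous_maxl => t; apply: cvgB; [exact: cX|exact: cvg_cst].
Qed.

(** The properties of convolution with [dG] that the argument uses. Vanishing at time 0 reflects the
    absence of an atom at 0. The factor [1 / 4] leaves room for the memory term in the Picard
    step. *)
Definition delay_operator (C : (R -> R) -> R -> R) := [/\
  forall p, continuous p -> continuous (C p),
  forall p q, continuous p -> continuous q ->
    forall t, C (fun u => p u - q u) t = C p t - C q t,
  forall p, C p 0 = 0 &
  exists2 al0, 0 < al0 & forall al, al0 <= al -> forall p, continuous p ->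
    forall T M, 0 <= M -> (forall u, 0 <= u <= T -> p u <= M * expR (al * u)) ->
    forall t, 0 <= t <= T -> C p t <= M / 4 * expR (al * t)].

Variable C : (R -> R) -> R -> R.
Hypothesis dC : delay_operator C.

(** The one-sided bound is applied to [p] and to [0 - p], since linearity is only available as
    compatibility with differences. *)
Lemma delay_operator_contract : exists2 al0, 0 < al0 &
  forall al, al0 <= al -> forall p, continuous p ->
    forall T M, 0 <= M -> (forall u, 0 <= u <= T -> `|p u| <= M * expR (al * u)) ->
    forall t, 0 <= t <= T -> `|C p t| <= M / 4 * expR (al * t).
Proof.
have [_ CB _ [al0 al00 h]] := dC; exists al0 => // al alal p cp T M M0 pM t tT.
have c0 : continuous (cst 0 : R -> R) by exact: cst_continuous.
have CC0 : C (cst 0) t = 0.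
  by rewrite -[RHS](subrr (C (cst 0) t)) -CB//; congr (C _ t); apply/funext => u /=; rewrite subr0.
have CN : C (fun u => cst 0 u - p u) t = - C p t by rewrite CB// CC0 sub0r.
rewrite ler_norml; apply/andP; split; last first.
  by apply: h tT => // u uT; apply: le_trans (pM u uT); exact: ler_norm.
rewrite lerNl -CN; apply: h tT => //.
  by move=> u; apply: cvgB; [exact: cvg_cst|exact: cp].
by move=> u uT; apply: le_trans (pM u uT); rewrite /= sub0r -normrN ler_norm.
Qed.

Definition volterra_solution w T X A := forall t, 0 <= t <= T ->
  X t = w t - A t + C (fun u => excess (X u) + A u) t.

(** The trace that monotonicity of the kernel leaves on its time integral. A queue longer by [rho]
    loses mass at least as fast, and when [X2 < 1] the second queue is empty and loses nothing. The
    margin [rho] absorbs the mismatch of two different kernels. *)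
Definition order_cond T rho X1 X2 A1 A2 := forall s t, 0 <= s -> s <= t -> t <= T ->
  (forall r, s < r -> r <= t -> excess (X2 r) + rho < excess (X1 r) \/ X2 r < 1) ->
  A1 s - A2 s <= A1 t - A2 t.

Let gap X1 X2 A1 A2 t := (excess (X2 t) + A2 t) - (excess (X1 t) + A1 t).

Let gapE w T X1 X2 A1 A2 : continuous X1 -> continuous X2 ->
  continuous A1 -> continuous A2 ->
  volterra_solution w T X1 A1 -> volterra_solution w T X2 A2 ->
  forall t, 0 <= t <= T ->
  Num.min (X1 t) 1 - Num.min (X2 t) 1 =
    gap X1 X2 A1 A2 t - C (gap X1 X2 A1 A2) t.
Proof.
move=> cX1 cX2 cA1 cA2 s1 s2 t tT.
have [_ CB _ _] := dC.
have cp X A : continuous X -> continuous A -> continuous (fun u => excess (X u) + A u).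
  by move=> cX cA u; apply: cvgD; [exact: continuous_excess|exact: cA].
rewrite /gap CB; [|exact: cp|exact: cp].
have := s1 t tT; have := s2 t tT.
have := excessE (X1 t); have := excessE (X2 t).
by move: (C _ _) (C _ _) => c1 c2; lra.
Qed.

Let initial w T X1 X2 A1 A2 : 0 <= T -> A1 0 = A2 0 ->
  volterra_solution w T X1 A1 -> volterra_solution w T X2 A2 -> X1 0 = X2 0.
Proof.
move=> T0 A0 s1 s2; have [_ _ C0 _] := dC.
by rewrite s1 ?lexx// s2 ?lexx// !C0 A0.
Qed.

(* Going back to the last time [s] at which neither the excess nor the capped
   part of [X1] exceeds that of [X2], the difference [A1 - A2] has increased. *)
Let gap_le w T rho X1 X2 A1 A2 : 0 <= rho -> continuous X1 -> continuous X2 ->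
  continuous A1 -> continuous A2 -> A1 0 = A2 0 ->
  volterra_solution w T X1 A1 -> volterra_solution w T X2 A2 ->
  order_cond T rho X1 X2 A1 A2 ->
  forall t, 0 <= t <= T -> exists2 s, 0 <= s <= t &
    gap X1 X2 A1 A2 t <= C (gap X1 X2 A1 A2) s + rho.
Proof.
move=> rho0 cX1 cX2 cA1 cA2 A0 s1 s2 oc t /andP[t0 tT].
have T0 := le_trans t0 tT.
have X0 := initial T0 A0 s1 s2.
pose de u := excess (X1 u) - excess (X2 u).
pose ze u := Num.min (X1 u) 1 - Num.min (X2 u) 1.
have cde : continuous de.
  by move=> u; apply: cvgB; exact: continuous_excess.
have cze : continuous ze.
  have -> : ze = (fun u => (X1 u - X2 u) - de u).
    apply/funext => u; rewrite /ze /de.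
    by have := excessE (X1 u); have := excessE (X2 u); lra.
  by move=> u; apply: cvgB; [apply: cvgB; [exact: cX1|exact: cX2]|exact: cde].
pose h u := Num.max (de u - rho) (ze u).
have ch : continuous h.
  by move=> u; apply: (@continuous_max _ _ (fun u => de u - rho) ze);
    [apply: cvgB; [exact: cde|exact: cvg_cst]|exact: cze].
have h0 : h 0 <= 0 by rewrite /h /de /ze X0 !subrr ge_max lexx sub0r oppr_le0 rho0.
have [s [s0 st hs hr]] := last_exit ch t0 h0.
have hrE r : 0 < h r -> excess (X2 r) + rho < excess (X1 r) \/ X2 r < 1.
  rewrite /h lt_max => /orP[|]; first by rewrite /de => ?; left; lra.
  rewrite /ze => z0; right; rewrite ltNge; apply/negP => h1.
  have : Num.min (X1 r) 1 <= 1 by rewrite ge_min lexx orbT.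
  by move: z0; rewrite (min_r h1); lra.
exists s; first by rewrite s0 st.
have gs : gap X1 X2 A1 A2 s <= C (gap X1 X2 A1 A2) s.
  have := gapE cX1 cX2 cA1 cA2 s1 s2 (t := s); rewrite s0 (le_trans st tT) => /(_ isT).
  by move: hs; rewrite /h ge_max /ze => /andP[_]; lra.
have [<-|snt] := eqVneq s t; first by rewrite (le_trans gs)// lerDl.
have lst : s < t by rewrite lt_neqAle snt.
have Ast : A1 s - A2 s <= A1 t - A2 t.
  by apply: oc => // r sr rt; apply: hrE; exact: hr.
have det : 0 <= de t.
  have := hrE t (hr t lst (lexx _)); rewrite /de => -[|X2t]; first by lra.
  have -> : excess (X2 t) = 0 by rewrite /excess; case: leP => // ?; lra.
  by rewrite subr0 /excess le_max lexx orbT.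
have des : de s <= rho by move: hs; rewrite /h ge_max => /andP[]; lra.
by move: gs det des Ast; rewrite /gap /de; lra.
Qed.

(** The gap is measured in the supremum norm with weight [expR (- (al * u))], where [C] contracts by
    4, so the estimate of the gap by [C] of itself at an earlier time closes up to [rho]. [K] is
    chosen before the memories. *)
Lemma volterra_stability T : 0 <= T -> exists2 K : R, 0 <= K &
  forall w rho X1 X2 A1 A2, 0 <= rho -> continuous X1 -> continuous X2 ->
  continuous A1 -> continuous A2 -> A1 0 = A2 0 ->
  volterra_solution w T X1 A1 -> volterra_solution w T X2 A2 ->
  order_cond T rho X1 X2 A1 A2 -> order_cond T rho X2 X1 A2 A1 ->
  forall t, 0 <= t <= T -> `|X1 t - X2 t| <= K * rho.
Proof.
move=> T0; have [al al0 hal] := delay_operator_contract.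
pose B := 2 * expR (al * T).
have B0 : 0 <= B by rewrite mulr_ge0// expR_ge0.
(* The excesses will differ by at most [(2 * B + 1) * rho] and the capped parts, whose difference is
   the gap minus its delay, by [2 * B * rho]. *)
exists (4 * B + 1); first by lra.
move=> w rho X1 X2 A1 A2 rho0 cX1 cX2 cA1 cA2 A0 s1 s2 oc12 oc21.
pose be := gap X1 X2 A1 A2.
have beN u : gap X2 X1 A2 A1 u = - be u by rewrite /be /gap; ring.
have cp X A : continuous X -> continuous A -> continuous (fun u => excess (X u) + A u).
  by move=> cX cA u; apply: cvgD; [exact: continuous_excess|exact: cA].
have cbe : continuous be by move=> u; apply: cvgB; exact: cp.
have CbeN u : C (gap X2 X1 A2 A1) u = - C be u.
  have [_ CB _ _] := dC.
  by rewrite /be /gap !CB ?opprB//; exact: cp.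
have : {within `[0, T], continuous (fun u => `|be u| * expR (- (al * u)))}.
  apply: continuous_subspaceT => u; apply: cvgM.
    by apply: cvg_norm; exact: cbe.
  apply: (@continuous_comp _ _ _ (fun u => - (al * u)) (@expR R)); last exact: continuous_expR.
  by apply: cvgN; apply: cvgM; [exact: cvg_cst|exact: cvg_id].
move=> /(EVT_max T0)[c]; rewrite in_itv/= => /andP[c0 cT] cmax.
(* [M] is the weighted norm of the gap on [[0, T]], attained at [c]; evaluating the estimate at [c]
   below cancels the weight and gives [M <= M / 4 + rho]. *)
set M := `|be c| * _ in cmax.
have M0 : 0 <= M by rewrite mulr_ge0// expR_ge0.
have beM u : 0 <= u <= T -> `|be u| <= M * expR (al * u).
  move=> uT; rewrite -ler_pdivrMr ?expR_gt0// -expRN; apply: cmax.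
  by rewrite in_itv/=.
have CbeM u : 0 <= u <= T -> `|C be u| <= M / 4 * expR (al * u).
  by move=> uT; apply: (hal al _ be _ T).
have ex s t : 0 <= s <= t -> expR (al * s) <= expR (al * t).
  by move=> /andP[_ st]; rewrite ler_expR ler_pM2l.
have ex1 t : 0 <= t -> 1 <= expR (al * t).
  by move=> t0; rewrite -expR0 ler_expR mulr_ge0// ltW.
have Mrho : M <= 2 * rho.
  have key t : 0 <= t <= T -> `|be t| <= (M / 4 + rho) * expR (al * t).
    move=> tT; have [t0 tT'] := andP tT.
    have aux s b : 0 <= s <= t -> `|b| <= M / 4 * expR (al * s) ->
        b + rho <= (M / 4 + rho) * expR (al * t).
      move=> st bM; have := ex1 t t0; have := ex s t st; have := ler_norm b.
      move: bM; set x := expR _; set y := expR _ => h1 h2 h3 h4.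
      have h5 : M / 4 * x <= M / 4 * y by rewrite ler_wpM2l// divr_ge0.
      have h6 : rho * 1 <= rho * y by rewrite ler_wpM2l.
      by rewrite mulrDl; lra.
    have sT s : 0 <= s <= t -> 0 <= s <= T.
      by move=> /andP[-> st]; exact: le_trans st tT'.
    have [s st bs] := gap_le rho0 cX1 cX2 cA1 cA2 A0 s1 s2 oc12 tT.
    have [s' st' bs'] := gap_le rho0 cX2 cX1 cA2 cA1 (esym A0) s2 s1 oc21 tT.
    rewrite beN CbeN in bs'.
    rewrite ler_norml; apply/andP; split.
      rewrite lerNl (le_trans bs')//; apply: (aux s') => //.
      by rewrite normrN CbeM// sT.
    by rewrite (le_trans bs)//; apply: (aux s) => //; rewrite CbeM// sT.
  have := key c; rewrite c0 cT => /(_ isT).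
  rewrite -ler_pdivrMr ?expR_gt0// -expRN => h.
  have : M <= M / 4 + rho by exact: h.
  by lra.
have beB u : 0 <= u <= T -> `|be u| <= B * rho.
  move=> uT; rewrite (le_trans (beM _ uT))// /B [leRHS]mulrAC.
  by apply: ler_pM; rewrite ?expR_ge0 ?ex.
have CbeB u : 0 <= u <= T -> `|C be u| <= B * rho.
  move=> uT; apply: (le_trans (CbeM _ uT)); apply: (@le_trans _ _ (M * expR (al * u))).
    by rewrite ler_wpM2r ?expR_ge0//; lra.
  rewrite /B [leRHS]mulrAC; apply: ler_pM; rewrite ?expR_ge0 ?ex//.
(* The gap only controls excess plus memory. To isolate the excess, go back to the last time [s] at
   which the excesses differ by at most [rho]: from there on [D1 - D2] has grown, so the difference
   at [t] is at most the gap at [s] minus the gap at [t], plus [rho]. *)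
have deB Y1 Y2 D1 D2 : continuous Y1 -> continuous Y2 -> Y1 0 = Y2 0 ->
    order_cond T rho Y1 Y2 D1 D2 ->
    (forall u, 0 <= u <= T -> `|gap Y1 Y2 D1 D2 u| <= B * rho) ->
    forall t, 0 <= t <= T -> excess (Y1 t) - excess (Y2 t) <= 2 * B * rho + rho.
  move=> cY1 cY2 Y0 oc gB t /andP[t0 tT].
  pose h u := excess (Y1 u) - excess (Y2 u) - rho.
  have ch : continuous h.
    by move=> u; apply: cvgB; [apply: cvgB; exact: continuous_excess|exact: cvg_cst].
  have h0 : h 0 <= 0 by rewrite /h Y0 subrr sub0r oppr_le0.
  have [s [s0 st hs hr]] := last_exit ch t0 h0.
  have : D1 s - D2 s <= D1 t - D2 t.
    by apply: oc => // r sr rt; left; have := hr r sr rt; rewrite /h; lra.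
  have := gB t; rewrite t0 tT => /(_ isT); rewrite ler_norml => /andP[+ _].
  have := gB s; rewrite s0 (le_trans st tT) => /(_ isT); rewrite ler_norml => /andP[_ +].
  by move: hs; rewrite /gap /h; lra.
move=> t tT.
have X0 := initial T0 A0 s1 s2.
have d1 := deB _ _ _ _ cX1 cX2 X0 oc12 beB t tT.
have d2 : excess (X2 t) - excess (X1 t) <= 2 * B * rho + rho.
  by apply: (deB _ _ _ _ cX2 cX1 (esym X0) oc21 _ t tT) => u uT; rewrite beN normrN beB.
have := gapE cX1 cX2 cA1 cA2 s1 s2 tT.
have := beB _ tT; have := CbeB _ tT; rewrite !ler_norml -/be.
have := excessE (X1 t); have := excessE (X2 t).
move=> e1 e2 /andP[g1 g2] /andP[g3 g4] e3.
by apply/andP; split; lra.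
Qed.

End Volterra.

(** * Picard iteration for Lipschitz memories *)

Section Picard.
Variables (R : realType) (C : (R -> R) -> R -> R).
Hypothesis dC : delay_operator C.

(** The factor [1 / al] is the gain from integrating [expR (al * u)] in time; [al] is quantified
    after [L], so it can be taken large against it. *)
Definition lipschitz_memory (A : (R -> R) -> R -> R) :=
  forall T : R, 0 <= T -> exists2 L : R, 0 <= L &
    forall X Y : R -> R, continuous X -> continuous Y ->
    forall al M : R, 0 < al -> 0 <= M ->
    (forall u, 0 <= u <= T -> `|X u - Y u| <= M * expR (al * u)) ->
    forall t, 0 <= t <= T -> `|A X t - A Y t| <= L / al * M * expR (al * t).

Variables (w : R -> R) (A : (R -> R) -> R -> R).
Hypothesis cw : continuous w.
Hypothesis cA : forall X, continuous X -> continuous (A X).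
Hypothesis lA : lipschitz_memory A.

(** Truncating time at 0 keeps the iterates constant on the negative half-line, as
    [locally_uniform_limit] demands. *)
Let step (X : R -> R) (t : R) := w (Num.max t 0) - A X (Num.max t 0) +
  C (fun u => excess (X u) + A X u) (Num.max t 0).

Let step_continuous (X : R -> R) : continuous X -> continuous (step X).
Proof.
move=> cX t; have [Cc _ _ _] := dC.
pose g t := w t - A X t + C (fun u => excess (X u) + A X u) t.
have cg : continuous g.
  move=> u; apply: cvgD; first by apply: cvgB; [exact: cw|exact: cA].
  by apply: Cc => v; apply: cvgD; [exact: continuous_excess|exact: cA].
have -> : step X = g \o (fun t => Num.max t 0) by [].
apply: continuous_comp; last exact: cg.
by apply: continuous_maxl => u; exact: cvg_id.
Qed.

Let stepE X t : 0 <= t -> step X t = w t - A X t + C (fun u => excess (X u) + A X u) t.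
Proof. by move=> t0; rewrite /step max_l. Qed.

Let step_contract (T : R) : 0 <= T -> exists2 al : R, 0 < al &
  forall X Y : R -> R, continuous X ->
  continuous Y -> forall M, 0 <= M ->
  (forall u, 0 <= u <= T -> `|X u - Y u| <= M * expR (al * u)) ->
  forall t, 0 <= t <= T -> `|step X t - step Y t| <= 3 / 4 * M * expR (al * t).
Proof.
move=> T0; have [L L0 hL] := lA T0.
have [al0 al00 hC] := delay_operator_contract dC.
have [_ CB _ _] := dC.
(* This makes [L / al <= 1 / 4]. The memory then contributes [1 / 4] and the delayed term
   [(1 + 1 / 4) / 4 = 5 / 16], in total less than [3 / 4]. *)
pose al := al0 + 4 * L.
have al_gt0 : 0 < al by rewrite /al; lra.
have Lal : L / al <= 1 / 4 by rewrite ler_pdivrMr// /al; lra.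
exists al => // X Y cX cY M M0 XY t tT; have [t0 _] := andP tT.
rewrite !stepE//.
have AXY u : 0 <= u <= T -> `|A X u - A Y u| <= 1 / 4 * M * expR (al * u).
  move=> uT; apply: (le_trans (hL X Y cX cY al M al_gt0 M0 XY u uT)).
  by rewrite ler_wpM2r ?expR_ge0// ler_wpM2r.
have cp Z : continuous Z -> continuous (fun u => excess (Z u) + A Z u).
  by move=> cZ u; apply: cvgD; [exact: continuous_excess|exact: cA].
pose p u := (excess (X u) + A X u) - (excess (Y u) + A Y u).
have pM u : 0 <= u <= T -> `|p u| <= 5 / 4 * M * expR (al * u).
  move=> uT; have := AXY u uT; have := XY u uT; have := excess_lip (X u) (Y u).
  have -> : p u = (excess (X u) - excess (Y u)) + (A X u - A Y u) by rewrite /p; ring.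
  have := ler_normD (excess (X u) - excess (Y u)) (A X u - A Y u).
  have : 5 / 4 * M * expR (al * u) = M * expR (al * u) + 1 / 4 * M * expR (al * u) by field.
  lra.
have CE : C (fun u => excess (X u) + A X u) t - C (fun u => excess (Y u) + A Y u) t = C p t.
  by rewrite CB//; exact: cp.
have -> : w t - A X t + C (fun u => excess (X u) + A X u) t -
  (w t - A Y t + C (fun u => excess (Y u) + A Y u) t) = C p t - (A X t - A Y t).
  by rewrite -CE; ring.
have cpp : continuous p by move=> u; apply: cvgB; exact: cp.
have al0al : al0 <= al by rewrite /al; lra.
have M5 : 0 <= 5 / 4 * M by lra.
have := hC al al0al p cpp T _ M5 pM t tT; have := AXY t tT.
have := ler_normB (C p t) (A X t - A Y t).
have Me : 0 <= M * expR (al * t) by rewrite mulr_ge0 ?expR_ge0.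
move: Me; set e := expR _ => Me h1 h2 h3.
by apply: (le_trans h1); lra.
Qed.

Lemma picard : exists X : R -> R, [/\ continuous X,
  forall t, X t = X (Num.max t 0) &
  forall t, 0 <= t -> X t = w t - A X t + C (fun u => excess (X u) + A X u) t].
Proof.
pose X n := iter n step (cst 0).
have cX n : continuous (X n).
  by elim: n => [|n IH]; [exact: cst_continuous|exact: step_continuous].
have Xmax n t : X n t = X n (Num.max t 0).
  case: n => [//|n]; rewrite /X/= /step.
  by rewrite (@max_l _ _ (Num.max t 0))// le_max lexx orbT.
have XC T : 0 <= T -> exists2 c : R, 0 <= c &
   forall n m t, (n <= m)%N -> 0 <= t <= T -> `|X n t - X m t| <= c * (3 / 4) ^+ n.
  move=> T0; have [al al0 hal] := step_contract T0.
  have : {within `[0, T], continuous (fun u => `|X 0%N u - X 1%N u|)}.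
    apply: continuous_subspaceT => u; apply: cvg_norm.
    by apply: cvgB; exact: cX.
  move=> /(EVT_max T0)[c _ cmax].
  set M := `|X 0%N c - _| in cmax.
  have M0 : 0 <= M by rewrite /M.
  have X1 n t : 0 <= t <= T -> `|X n t - X n.+1 t| <= (3 / 4) ^+ n * M * expR (al * t).
    elim: n t => [|n IH] t tT.
      rewrite expr0 mul1r; apply: (@le_trans _ _ M).
        by apply: cmax; rewrite in_itv/=.
      rewrite ler_peMr// -expR0 ler_expR mulr_ge0//; first exact: ltW.
      by case/andP: tT.
    rewrite exprS -(mulrA (3 / 4)).
    by apply: (hal (X n) (X n.+1)) => //; rewrite mulr_ge0// exprn_ge0.
  exists (4 * (M * expR (al * T))); first by rewrite mulr_ge0// mulr_ge0// expR_ge0.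
  move=> n m t nm tT; set B := M * _.
  have B0 : 0 <= B by rewrite mulr_ge0// expR_ge0.
  have X2 k : `|X k t - X k.+1 t| <= (3 / 4) ^+ k * B.
    apply: (le_trans (X1 k t tT)); rewrite -mulrA ler_wpM2l ?exprn_ge0//.
    rewrite ler_wpM2l// ler_expR ler_pM2l//; by case/andP: tT.
  (* The exact partial geometric sum, with [4 = 1 / (1 - 3 / 4)], is the form that passes through
     the induction on [m - n]. *)
  suff : `|X n t - X m t| <= 4 * B * ((3 / 4) ^+ n - (3 / 4) ^+ m).
    move=> h; apply: (le_trans h); rewrite ler_wpM2l//; first by lra.
    by rewrite gerBl exprn_ge0.
  rewrite -(subnKC nm); elim: (m - n)%N => [|k IH].
    by rewrite addn0 !subrr normr0 mulr0.
  rewrite addnS -(subrKA (X (n + k)%N t)).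
  apply: (le_trans (ler_normD _ _)); apply: (le_trans (lerD IH (X2 _))).
  rewrite [X in _ <= _ * (_ - X)]exprS; move: (_ ^+ (n + k)) => y.
  by rewrite !mulrBr; lra.
have geo (c : R) : c * (3 / 4) ^+ n @[n --> \oo] --> 0.
  rewrite -[X in _ --> X](mulr0 c); apply: cvgM; first exact: cvg_cst.
  by apply: cvg_expr; rewrite ger0_norm; lra.
have [Y [cY Ymax hY]] : exists g : R -> R, [/\ continuous g,
    (forall t, g t = g (Num.max t 0)) &
    forall T, 0 <= T -> exists e : nat -> R, e @ \oo --> 0 /\
     forall n t, 0 <= t <= T -> `|X n t - g t| <= e n].
  apply: locally_uniform_limit => // T T0; have [c c0 hc] := XC T T0.
  by exists (fun n => c * (3 / 4) ^+ n); split.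
exists Y; split => // t t0; rewrite -stepE//.
have [e [e0 he]] := hY t t0.
have [al al0 hal] := step_contract t0.
have tt : 0 <= t <= t by rewrite t0 lexx.
apply/eqP; rewrite -subr_eq0 -normr_le0.
have bnd n : `|Y t - step Y t| <= e n.+1 + 3 / 4 * e n * expR (al * t).
  have en0 : 0 <= e n by apply: le_trans (he n t tt); exact: normr_ge0.
  rewrite -(subrKA (X n.+1 t)); apply: (le_trans (ler_normD _ _)).
  apply: lerD; first by rewrite distrC he.
  apply: (hal (X n) Y) => // u /andP[u0 ut].
  apply: (@le_trans _ _ (e n)); first by apply: he; rewrite u0.
  by rewrite ler_peMr// -expR0 ler_expR mulr_ge0// ltW.
have lim0 : e n.+1 + 3 / 4 * e n * expR (al * t) @[n --> \oo] --> 0 + 3 / 4 * 0 * expR (al * t).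
  apply: cvgD; first by rewrite (cvg_shiftS e).
  apply: cvgM; last exact: cvg_cst.
  by apply: cvgM; [exact: cvg_cst|exact: e0].
rewrite mulr0 mul0r addr0 in lim0.
rewrite -(cvg_lim _ lim0)//; apply: limr_ge; first by apply/cvg_ex; exists 0.
by apply: nearW.
Qed.

End Picard.

(** Picard solves the equation for each [An n], and stability with [rho = 1 / (n + 1)] makes these
    solutions Cauchy, locally uniformly. The last hypothesis, which passes from pointwise
    convergence of paths to uniform convergence of memories, is shaped after what dominated
    convergence delivers. *)
Lemma volterra_existence (R : realType) (C : (R -> R) -> R -> R) (w : R -> R)
    (A : (R -> R) -> R -> R) (An : nat -> (R -> R) -> R -> R) :
  delay_operator C -> continuous w ->
  (forall X, continuous X -> continuous (A X)) ->
  (forall n X, continuous X -> continuous (An n X)) ->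
  (forall n X, An n X 0 = 0) ->
  (forall n, lipschitz_memory (An n)) ->
  (forall T n m X1 X2, (n <= m)%N -> continuous X1 -> continuous X2 ->
     order_cond T n.+1%:R^-1 X1 X2 (An n X1) (An m X2) /\
     order_cond T n.+1%:R^-1 X2 X1 (An m X2) (An n X1)) ->
  (forall (Xn : nat -> R -> R) X, (forall n, continuous (Xn n)) -> continuous X ->
     (forall t, 0 <= t -> Xn n t @[n --> \oo] --> X t) ->
     forall T, 0 <= T -> exists e : nat -> R, e @ \oo --> 0 /\
       forall n t, 0 <= t <= T -> `|An n (Xn n) t - A X t| <= e n) ->
  exists2 X : R -> R, continuous X &
  forall t, 0 <= t -> X t = w t - A X t + C (fun u => excess (X u) + A X u) t.
Proof.
move=> dC cw cA cAn An0 lA oA limA.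
have max0 (t : R) : 0 <= Num.max t 0 by rewrite le_max lexx orbT.
have maxmax (t : R) : Num.max (Num.max t 0) 0 = Num.max t 0 by rewrite max_l.
have /choice[Xn hXn] n : exists X : R -> R, [/\ continuous X,
    (forall t, X t = X (Num.max t 0)) &
    forall t, 0 <= t -> X t = w t - An n X t + C (fun u => excess (X u) + An n X u) t].
  exact: (picard dC cw (cAn n) (lA n)).
have cXn n : continuous (Xn n) by have [] := hXn n.
have lXn T : 0 <= T -> exists e : nat -> R, e @ \oo --> 0 /\
     forall n m t, (n <= m)%N -> 0 <= t <= T -> `|Xn n t - Xn m t| <= e n.
  move=> T0; have [K K0 hK] := volterra_stability dC T0.
  exists (fun n => K * n.+1%:R^-1); split.
    rewrite -[X in _ --> X](mulr0 K); apply: cvgM; first exact: cvg_cst.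
    exact: cvg_harmonic.
  move=> n m t nm tT; have [ord1 ord2] := oA T n m _ _ nm (cXn n) (cXn m).
  apply: (hK w _ _ _ (An n (Xn n)) (An m (Xn m))) => //.
  - exact: cAn.
  - exact: cAn.
  - by rewrite !An0.
  - by move=> u /andP[u0 _]; have [_ _ h] := hXn n; exact: h.
  - by move=> u /andP[u0 _]; have [_ _ h] := hXn m; exact: h.
have [X [cX Xmax hX]] := locally_uniform_limit cXn (fun n => let: And3 _ h _ := hXn n in h) lXn.
exists X => // t t0.
have cvX s : 0 <= s -> Xn n s @[n --> \oo] --> X s.
  move=> s0; have [e [e0 he]] := hX s s0.
  apply/cvgrPdist_le => eps eps0.
  have [N _ hN] := (cvgrPdist_lt _ _).1 e0 _ eps0.
  exists N => // n /= Nn; rewrite distrC (le_trans (he n s _))//; first by rewrite s0 lexx.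
  have := hN n Nn; rewrite sub0r normrN => h.
  exact: (le_trans (ler_norm _) (ltW h)).
have [e [e0 he]] := hX t t0.
have [a [a0 ha]] := limA Xn X cXn cX cvX t t0.
have [al al_gt0 hC] := delay_operator_contract dC.
have [_ CB _ _] := dC.
have t_t : 0 <= t <= t by rewrite t0 lexx.
apply/eqP; rewrite -subr_eq0 -normr_le0.
pose p n u := (excess (Xn n u) + An n (Xn n) u) - (excess (X u) + A X u).
have cp (Z B : R -> R) : continuous Z -> continuous B -> continuous (fun u : R => excess (Z u) + B u).
  by move=> cZ cB u; apply: cvgD; [exact: continuous_excess|exact: cB].
have cpn n : continuous (p n).
  by move=> u; apply: cvgB; apply: cp => //; [exact: cAn|exact: cA].
have pn n u : 0 <= u <= t -> `|p n u| <= e n + a n.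
  move=> ut.
  have -> : p n u = (excess (Xn n u) - excess (X u)) + (An n (Xn n) u - A X u).
    by rewrite /p; ring.
  apply: (le_trans (ler_normD _ _)); apply: lerD; last exact: ha.
  exact: (le_trans (excess_lip _ _) (he n u ut)).
(* The residual of the limit is compared with the equation of [Xn n], whose residual is zero: what
   remains are the errors in the path, in the memory and in the delayed term. *)
have bnd n : `|X t - (w t - A X t + C (fun u => excess (X u) + A X u) t)| <=
    e n + a n + (e n + a n) / 4 * expR (al * t).
  have ea0 : 0 <= e n + a n by apply: le_trans (pn n t t_t); exact: normr_ge0.
  have Cp : `|C (p n) t| <= (e n + a n) / 4 * expR (al * t).
    apply: (hC al (lexx _) _ (cpn n) t) => // u ut.
    apply: (le_trans (pn n u ut)); rewrite ler_peMr// -expR0 ler_expR.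
    by rewrite mulr_ge0//; [exact: ltW|case/andP: ut].
  have [_ _ /(_ t t0) Xnt] := hXn n.
  have CE : C (p n) t = C (fun u => excess (Xn n u) + An n (Xn n) u) t -
      C (fun u => excess (X u) + A X u) t.
    by rewrite -CB//; apply: cp => //; [exact: cAn|exact: cA].
  have -> : X t - (w t - A X t + C (fun u => excess (X u) + A X u) t) =
      C (p n) t - (Xn n t - X t) - (An n (Xn n) t - A X t).
    by rewrite CE {1}Xnt; ring.
  apply: (le_trans (ler_normB _ _)).
  have := he n t t_t; have := ha n t t_t; have := ler_normB (C (p n) t) (Xn n t - X t).
  by move: Cp; lra.
have lim0 : e n + a n + (e n + a n) / 4 * expR (al * t) @[n --> \oo] -->
    0 + 0 + (0 + 0) / 4 * expR (al * t).
  apply: cvgD; first exact: cvgD.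
  apply: cvgM; last exact: cvg_cst.
  by apply: cvgM; [exact: cvgD|exact: cvg_cst].
rewrite !(addr0, mul0r) in lim0.
rewrite -(cvg_lim _ lim0)//; apply: limr_ge; first by apply/cvg_ex; exists 0.
by apply: nearW.
Qed.

(** * Convolution with the service time distribution *)

Section measure_facts.
Context d (T : measurableType d) (R : realType).
Variable m : {measure set T -> \bar R}.

Lemma integrable_of_bound (D : set T) (f : T -> R) (M : R) : measurable D ->
  (m D < +oo)%E -> measurable_fun D f -> (forall x, D x -> `|f x| <= M) ->
  m.-integrable D (EFin \o f).
Proof.
move=> mD Doo mf fM; apply: measurable_bounded_integrable => //.
exists M; split; first exact: num_real.
by move=> x Mx y Dy; apply: (le_trans (fM y Dy)); exact: ltW.
Qed.

Lemma Rintegral_le_bound (D : set T) (f : T -> R) (M : R) : measurable D ->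
  (m D < +oo)%E -> measurable_fun D f -> (forall x, D x -> `|f x| <= M) ->
  `|\int[m]_(x in D) f x| <= M * fine (m D).
Proof.
move=> mD Doo mf fM; have intf := integrable_of_bound mD Doo mf fM.
apply: (le_trans (le_normr_Rintegral mD intf)).
rewrite -Rintegral_cst//; apply: le_Rintegral => //.
- apply: (@integrable_of_bound _ _ M) => //; first exact: measurableT_comp.
  by move=> x Dx; rewrite normr_id fM.
- by apply: (@integrable_of_bound _ _ `|M|).
Qed.

Lemma integrable_scale (D : set T) (f : T -> R) (c : R) : measurable D ->
  m.-integrable D (EFin \o f) -> m.-integrable D (EFin \o (fun x => c * f x)).
Proof. by move=> mD intf; exact: (integrableZl mD c intf). Qed.

Lemma integrable_sub (D : set T) (f g : T -> R) : measurable D ->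
  m.-integrable D (EFin \o f) -> m.-integrable D (EFin \o g) ->
  m.-integrable D (EFin \o (fun x => f x - g x)).
Proof. by move=> mD intf intg; exact: (integrableB mD intf intg). Qed.
End measure_facts.

Lemma continuous_bounded_itv (R : realType) (p : R -> R) (a b : R) : continuous p ->
  exists2 M : R, 0 <= M & forall x, a <= x <= b -> `|p x| <= M.
Proof.
move=> cp; have [ab|ba] := leP a b; last first.
  by exists 0 => // x /andP[ax xb]; move: (le_trans ax xb); rewrite leNgt ba.
have : {within `[a, b], continuous (fun u => `|p u|)}.
  by apply: continuous_subspaceT => u; apply: cvg_norm; exact: cp.
by move=> /(EVT_max ab)[c _ cmax]; exists `|p c| => // x xab; apply: cmax; rewrite in_itv.
Qed.

Section delay_measure.
Variables (R : realType) (G : cumulativeBounded (0 : R) (1 : R)).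
Hypothesis G_nneg : forall x : R, x < 0 -> G x = 0.
Hypothesis G_cont : continuous G.
Local Notation nu := (lebesgue_stieltjes_measure G).

Definition delay (p : R -> R) (t : R) := \int[nu]_(s in `[0, t]) p (t - s).


Lemma cdf0 : G 0 = 0.
Proof.
have h : G z @[z --> 0^'-] --> G 0 by apply: cvg_at_left_filter; exact: G_cont.
rewrite -(cvg_lim _ h)//; apply: cvg_lim => //.
apply: (@cvg_trans _ ((cst 0 : R -> R) z @[z --> (0 : R)^'-])); last exact: cvg_cst.
by apply: near_eq_cvg; near=> z; rewrite /= G_nneg.
Unshelve. all: by end_near. Qed.

Lemma cdf_ge0 x : 0 <= G x.
Proof.
have [x0|x0] := ltP x 0; first by rewrite G_nneg.
apply: (@le_trans _ _ (G 0)); first by rewrite cdf0.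
by apply: (cumulative_is_nondecreasing G).
Qed.

Lemma nu_itvNy t : nu `]-oo, t]%classic = (G t)%:E.
Proof. by rewrite -cdf_lebesgue_stieltjes_id /cdf /distribution /pushforward preimage_id. Qed.

(** The open negative half-line is null because its mass is at most [G 0 = 0], so removing it costs
    nothing. *)
Lemma nu_itv0 t : nu `[0, t]%classic = (G t)%:E.
Proof.
have [t0|t0] := ltP t 0.
  by rewrite set_itv_ge ?bnd_simp -?ltNge// measure0 G_nneg.
have nu0 : nu `]-oo, 0[%classic = 0%E.
  apply/eqP; rewrite eq_le measure_ge0 andbT.
  have -> : 0%E = nu `]-oo, (0:R)]%classic by rewrite nu_itvNy cdf0.
  by apply: le_measure; rewrite ?inE//; apply: subset_itvl; rewrite bnd_simp.
rewrite -nu_itvNy (@itv_bndbnd_setU _ _ -oo%O (BLeft 0) (BRight t)) ?bnd_simp//.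
rewrite -[LHS]add0e -nu0; apply/esym/measureU => //.
rewrite -subset0 => x []/=; rewrite !in_itv/= => x0 /andP[].
by rewrite leNgt x0.
Qed.

Lemma cdf_le1 t : G t <= 1.
Proof. by rewrite -lee_fin -nu_itv0; exact: probability_le1. Qed.

Lemma nu_itv_lty t : (nu `[0%R, t]%classic < +oo)%E.
Proof. by rewrite nu_itv0 ltry. Qed.

Lemma delay_integrable p t : continuous p ->
  nu.-integrable `[0, t] (EFin \o (fun s => p (t - s))).
Proof.
move=> cp; have [M M0 pM] := continuous_bounded_itv 0 t cp.
apply: (@integrable_of_bound _ _ _ _ _ _ M) => //; first exact: nu_itv_lty.
  apply: measurable_funTS; apply: continuous_measurable_fun => s.
  apply: (@continuous_comp _ _ _ (fun s => t - s) p); last exact: cp.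
  by apply: cvgB; [exact: cvg_cst|exact: cvg_id].
move=> s /=; rewrite in_itv/= => /andP[s0 st]; apply: pM.
by rewrite subr_ge0 st gerBl.
Qed.

Lemma delayB p q t : continuous p -> continuous q ->
  delay (fun u => p u - q u) t = delay p t - delay q t.
Proof. by move=> cp cq; rewrite /delay RintegralB//; exact: delay_integrable. Qed.

Lemma delay0 p : delay p 0 = 0.
Proof.
have nu00 : nu `[(0:R), 0]%classic = 0%E by rewrite nu_itv0 cdf0.
rewrite /delay /Rintegral null_set_integral//.
by rewrite set_itv1; exact: measurable_fun_set1.
Qed.

(* The integrand [p (t - s) - p 0], extended by [0] to [s > t], depends
   continuously on [t], unlike the indicator of [`[0, t]]. *)
Lemma delayE p t : continuous p -> delay p t =
  \int[nu]_(s in `[0, +oo[) (p (Num.max (t - s) 0) - p 0) + p 0 * G t.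
Proof.
move=> cp.
have ci := delay_integrable t (@cst_continuous R R (p 0)).
have -> : p 0 * G t = \int[nu]_(s in `[0, t]) cst (p 0) (t - s).
  by rewrite /= Rintegral_cst// -[G t]/(fine (G t)%:E) -nu_itv0.
have -> : \int[nu]_(s in `[0, +oo[) (p (Num.max (t - s) 0) - p 0) =
    \int[nu]_(s in `[0, t]) (p (t - s) - p 0).
  rewrite Rintegral_mkcond [RHS]Rintegral_mkcond; congr (Rintegral _ _ _).
  apply/funext => s; rewrite /patch !mem_setE !in_itv/= andbT.
  have [s0|s0] //= := leP 0 s.
  have [st|st] := leP s t; first by rewrite max_l// subr_ge0.
  by rewrite max_r ?subrr// subr_le0 ltW.
rewrite RintegralB//; last exact: delay_integrable.
by rewrite subrK.
Qed.

Lemma delay_continuous p : continuous p -> continuous (delay p).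
Proof.
move=> cp; have -> : delay p = (fun t =>
    \int[nu]_(s in `[0, +oo[) (p (Num.max (t - s) 0) - p 0) + p 0 * G t).
  by apply/funext => t; exact: delayE.
move=> t; apply: cvgD; last by apply: cvgM; [exact: cvg_cst|exact: G_cont].
have [M M0 pM] := continuous_bounded_itv 0 (Num.max (t + 1) 0) cp.
have cps (s : R) : continuous (fun t => p (Num.max (t - s) 0) - p 0).
  move=> r; apply: cvgB; last exact: cvg_cst.
  apply: (@continuous_comp _ _ _ (fun t => Num.max (t - s) 0) p); last exact: cp.
  by apply: continuous_maxl => u; apply: cvgB; [exact: cvg_id|exact: cvg_cst].
have nuy : (nu `[0%R, +oo[%classic < +oo)%E.
  by rewrite ltey_eq fin_num_measure.
(* For [r] near [t] the argument of [p] stays in one compact interval, so a constant dominates the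
   integrand; it is integrable because the measure is finite. *)
have bnd r s : r < t + 1 -> 0 <= s -> `|p (Num.max (r - s) 0) - p 0| <= M + M.
  move=> rt s0; apply: (le_trans (ler_normB _ _)).
  apply: lerD; apply: pM; last by rewrite lexx le_max lexx orbT.
  rewrite le_max lexx orbT/= ge_max; apply/andP; split; last by rewrite le_max lexx orbT.
  by rewrite le_max; apply/orP; left; lra.
have tI : t \in `]t - 1, t + 1[%classic by rewrite inE/= in_itv/=; apply/andP; split; lra.
apply: (@continuity_under_integral _ _ _ nu
  (fun t s => p (Num.max (t - s) 0) - p 0) `[0, +oo[%classic _ (t - 1) (t + 1) _ _
  (cst (M + M)) _ _ t tI) => //.
- move=> r /=; rewrite in_itv/= => /andP[_ rt].
  apply: (@integrable_of_bound _ _ _ _ _ _ (M + M)) => //.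
    apply: measurable_funTS; apply: measurable_funB => //.
    apply: continuous_measurable_fun => s.
    apply: (@continuous_comp _ _ _ (fun s => Num.max (r - s) 0) p); last exact: cp.
    by apply: continuous_maxl => u; apply: cvgB; [exact: cvg_cst|exact: cvg_id].
  by move=> s /=; rewrite in_itv/= andbT => s0; exact: bnd.
- by apply: aeW => s _ r _; exact: cps.
- apply: (@integrable_of_bound _ _ _ _ _ _ (M + M)) => //.
  by move=> s _ /=; rewrite ger0_norm// addr_ge0.
- move=> r /=; rewrite in_itv/= => /andP[_ rt]; apply: aeW => s/=.
  by rewrite in_itv/= andbT => s0; exact: bnd.
Qed.

(** Short delays carry little mass, as [G] is continuous with [G 0 = 0], and long delays are damped
    by the weight: the integral of [expR (- (al * s))] against [dG] is at most [1 / 8 + 1 / 8]. *)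
Lemma delay_contract : exists2 al0 : R, 0 < al0 &
  forall al : R, al0 <= al -> forall p : R -> R, continuous p ->
    forall T M : R, 0 <= M -> (forall u, 0 <= u <= T -> p u <= M * expR (al * u)) ->
    forall t, 0 <= t <= T -> delay p t <= M / 4 * expR (al * t).
Proof.
have /cvgrPdist_lt/(_ (1 / 8)) : G z @[z --> (0 : R)] --> G 0 by exact: G_cont.
rewrite divr_gt0// => /(_ isT)[/= tau tau0 htau].
have Gtau : G (tau / 2) <= 1 / 8.
  have /htau : ball_ Num.norm 0 tau (tau / 2).
    by rewrite /= sub0r normrN ger0_norm; lra.
  by rewrite cdf0 sub0r normrN => /ltW; rewrite ger0_norm// cdf_ge0.
(* With this choice [al * s >= 8] once [s > tau / 2], and [expR 8 >= 1 + 8] brings the weight below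
   [1 / 8]. *)
exists (16 / tau); first by rewrite divr_gt0.
move=> al al16 p cp T M M0 pM t /andP[t0 tT].
have al0 : 0 < al by rewrite (lt_le_trans _ al16)// divr_gt0.
pose phi (s : R) := (if s <= tau / 2 then 1 else 0) + 1 / 8 : R.
have mphi : measurable_fun setT phi.
  apply: measurable_funD => //; apply: measurable_fun_ifT => //.
  exact: measurable_fun_ler.
have iphi : nu.-integrable `[0, t] (EFin \o phi).
  apply: (@integrable_of_bound _ _ _ _ _ _ 2) => //; first exact: nu_itv_lty.
    exact: measurable_funTS.
  by move=> s _; rewrite /phi; case: ifP => _; rewrite ger0_norm; lra.
have ephi s : 0 <= s -> expR (- (al * s)) <= phi s.
  move=> s0; rewrite /phi; case: ifPn => [_|].
    have : expR (- (al * s)) <= 1.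
      by rewrite -expR0 ler_expR oppr_le0 mulr_ge0// ltW.
    by lra.
  rewrite -ltNge => taus; rewrite add0r expRN.
  have h8 : 8 <= al * s.
    apply: (@le_trans _ _ (16 / tau * (tau / 2))).
      by rewrite mulrA divfK ?gt_eqF//; lra.
    by apply: ler_pM => //; [rewrite divr_ge0// ltW|lra|exact: ltW].
  have : 8 <= expR (al * s) by have := expR_ge1Dx (al * s); lra.
  by move=> h; rewrite div1r lef_pV2// posrE ?expR_gt0.
have e0 := expR_ge0 (al * t).
apply: (@le_trans _ _ (\int[nu]_(s in `[0, t]) (M * expR (al * t) * phi s))).
  apply: le_Rintegral => //; first exact: delay_integrable.
    have -> : EFin \o (fun s => M * expR (al * t) * phi s) =
      (fun s => (M * expR (al * t))%:E * (EFin \o phi) s)%E by [].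
    exact: integrableZl.
  move=> s /=; rewrite in_itv/= => /andP[s0 st].
  apply: (@le_trans _ _ (M * expR (al * (t - s)))).
    apply: pM; rewrite subr_ge0 st/=; lra.
  rewrite mulrBr expRD -mulrA ler_wpM2l// ler_wpM2l//; exact: ephi.
rewrite RintegralZl// [M / 4 * _]mulrAC -!mulrA ler_wpM2l// ler_wpM2l//.
rewrite /phi RintegralD//; last 2 first.
- apply: (@integrable_of_bound _ _ _ _ _ _ 1) => //; first exact: nu_itv_lty.
    apply: measurable_funTS; apply: measurable_fun_ifT => //.
    exact: measurable_fun_ler.
  by move=> s _; case: ifP; rewrite ?normr1 ?normr0.
- apply: (@integrable_of_bound _ _ _ _ _ _ 1) => //; first exact: nu_itv_lty.
  by move=> s _; rewrite ger0_norm; lra.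
rewrite Rintegral_cst//.
have nuG : fine (nu `[0, t]%classic) = G t by rewrite nu_itv0.
have G1 := cdf_le1 t.
have : \int[nu]_(s in `[0, t]) (if s <= tau / 2 then 1 else 0) <= 1 / 8.
  apply: le_trans Gtau.
  have -> : G (tau / 2) = \int[nu]_(s in `[0, tau / 2]) 1.
    by rewrite Rintegral_cst// mul1r -[LHS]/(fine (G _)%:E) -nu_itv0.
  rewrite Rintegral_mkcond [leRHS]Rintegral_mkcond; apply: le_Rintegral => //.
  - apply: (@integrable_of_bound _ _ _ _ _ _ 1) => //.
      by rewrite ltey_eq fin_num_measure.
      apply: (iffLR (measurable_restrictT _ _)) => //.
      apply: measurable_funTS; apply: measurable_fun_ifT => //.
      exact: measurable_fun_ler.
    by move=> s _; rewrite /patch; case: ifP => _; rewrite ?normr0//;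
      case: ifP => _; rewrite ?normr1 ?normr0.
  - apply: (@integrable_of_bound _ _ _ _ _ _ 1) => //.
      by rewrite ltey_eq fin_num_measure.
      apply: (iffLR (measurable_restrictT _ _)) => //.
    by move=> s _; rewrite /patch; case: ifP; rewrite ?normr1 ?normr0.
  - move=> s _; rewrite /patch !mem_setE !in_itv/=.
    by have [s0|s0] //= := leP 0 s; case: (s <= tau / 2); case: (s <= t).
lra.
Qed.

Lemma delay_delay_operator : delay_operator delay.
Proof.
split; [exact: delay_continuous|by move=> p q cp cq t; exact: delayB|exact: delay0|].
exact: delay_contract.
Qed.

End delay_measure.

(** * Lebesgue integration lemmas *)

Section difference_quotient.
Variables (R : realType) (f : R -> R).
Hypothesis cf : continuous f.

Let q (h x : R) := h^-1 * (f (h + x) - f x).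

Let continuous_q h : continuous (q h).
Proof.
move=> x; apply: cvgM; first exact: cvg_cst.
apply: cvgB; last exact: cf.
apply: (@continuous_comp _ _ _ (fun x => h + x) f); last exact: cf.
by apply: cvgD; [exact: cvg_cst|exact: cvg_id].
Qed.

Lemma derive1_dvg x : ~ cvg (q h x @[h --> 0^']) -> derive1 f x = 0.
Proof.
exact: dvgP.
Qed.

Lemma derive1_cvg x : cvg (q h x @[h --> 0^']) -> q h x @[h --> 0^'] --> derive1 f x.
Proof. by []. Qed.

(** A quantified Cauchy criterion for the difference quotients. For fixed increments the condition
    is closed in [x], because [f] is continuous, so the set of differentiability is a countable
    intersection of countable unions of closed sets. *)
Let cauchy_set (k n : nat) := [set x | forall h h' : R, h != 0 -> h' != 0 ->
  `|h| < n.+1%:R^-1 -> `|h'| < n.+1%:R^-1 -> `|q h x - q h' x| <= k.+1%:R^-1].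

Let closed_cauchy_set k n : closed (cauchy_set k n).
Proof.
have -> : cauchy_set k n = \bigcap_(hh in [set hh : R * R | [/\ hh.1 != 0, hh.2 != 0,
    `|hh.1| < n.+1%:R^-1 & `|hh.2| < n.+1%:R^-1]])
    ((fun x => `|q hh.1 x - q hh.2 x|) @^-1` `]-oo, k.+1%:R^-1]%classic).
  apply/seteqP; split => [x hx [h h'] [/= h0 h0' hn hn']|x hx h h' h0 h0' hn hn'] /=.
    by rewrite in_itv/=; exact: hx.
  by have := hx (h, h'); rewrite /= in_itv/=; apply.
apply: closed_bigI => hh _; apply: preimage_closed => // x _.
by apply: cvg_norm; apply: cvgB; exact: continuous_q.
Qed.

Let cvg_setE : [set x | cvg (q h x @[h --> 0^'])] =
  \bigcap_k \bigcup_n cauchy_set k n.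
Proof.
apply/seteqP; split => [x /= cx k _|x hx /=].
  have k2 : 0 < k.+1%:R^-1 / 2 :> R by rewrite divr_gt0// invr_gt0.
  have /cvgrPdist_lt/(_ _ k2) [/= e e0 he] := cx.
  have [n ne] : exists n : nat, n.+1%:R^-1 < e.
    have [N _ hN] := near_infty_natSinv_lt (PosNum e0).
    by exists N; exact: (hN N (leqnn N)).
  exists n => // h h' h0 h0' hn hn'.
  have key r : r != 0 -> `|r| < n.+1%:R^-1 -> `|lim (q h x @[h --> 0^']) - q r x| < k.+1%:R^-1 / 2.
    move=> r0 rn; apply: he => //.
    by rewrite /= sub0r normrN (lt_trans rn).
  rewrite (splitr k.+1%:R^-1) -(subrKA (lim (q h x @[h --> 0^']))).
  rewrite (le_trans (ler_normD _ _))// lerD ?ltW ?key//.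
  by rewrite distrC key.
apply/cauchy_cvgP; apply: cauchy_exP => e e0.
have [k ke] : exists k : nat, k.+1%:R^-1 < e.
  have [N _ hN] := near_infty_natSinv_lt (PosNum e0).
  by exists N; exact: (hN N (leqnn N)).
have [n _ hn] := hx k I.
have n0 : 0 < n.+1%:R^-1 / 2 :> R by rewrite divr_gt0// invr_gt0.
have n1 : `|n.+1%:R^-1 / 2| < n.+1%:R^-1 :> R.
  by rewrite ger0_norm ?ltW// ltr_pdivrMr// ltr_pMr ?invr_gt0// ltr1n.
exists (q (n.+1%:R^-1 / 2) x); exists n.+1%:R^-1; first by rewrite /= invr_gt0.
move=> h /=; rewrite sub0r normrN => hlt h0.
by rewrite -ball_normE/= (le_lt_trans _ ke)//; apply: hn => //; rewrite gt_eqF.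
Qed.

(** On the measurable set [D] of differentiability, [derive1 f] is the limit of the continuous
    quotients with increments [1 / (n + 1)]; off [D] it takes the default value 0. *)
Lemma derive1_measurable : measurable_fun setT (derive1 f).
Proof.
pose D := [set x | cvg (q h x @[h --> 0^'])].
have mD : measurable D.
  rewrite /D cvg_setE; apply: bigcap_measurable => // k _.
  apply: bigcup_measurable => n _; exact: closed_measurable.
have -> : derive1 f = (derive1 f) \_ D.
  apply/funext => x; rewrite /patch; case: ifPn => // /negP xD.
  by apply: derive1_dvg => cx; apply: xD; rewrite inE.
apply/(measurable_restrictT _ mD).
apply: (@measurable_fun_cvg _ _ _ _ (fun n => q n.+1%:R^-1)) => //.
  by move=> n; apply: measurable_funTS; exact: continuous_measurable_fun.
move=> x Dx; have := derive1_cvg Dx => /cvgrPdist_lt h.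
apply/cvgrPdist_lt => e /h[/= d d0 hd].
have [N _ hN] := near_infty_natSinv_lt (PosNum d0).
exists N => // n Nn; apply: hd; last by rewrite /= invr_neq0.
by rewrite /= sub0r normrN ger0_norm ?invr_ge0//; exact: hN.
Qed.

(** The condition [a <= 0 <= b] covers the default value 0 at points without derivative. *)
Lemma derive1_bounds (a b : R) x :
  a <= 0 <= b -> (forall h, h != 0 -> a <= q h x <= b) -> a <= derive1 f x <= b.
Proof.
move=> /andP[a0 b0] hq.
have [cx|dx] := pselect (cvg (q h x @[h --> 0^'])); last first.
  by rewrite derive1_dvg// a0.
have hn : \forall h \near 0^', a <= q h x <= b.
  by near=> h; apply: hq; near: h; exact: nbhs_dnbhs_neq.
apply/andP; split.
  by apply: limr_ge => //; apply: filterS hn => h /andP[].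
by apply: limr_le => //; apply: filterS hn => h /andP[].
Unshelve. all: by end_near. Qed.

End difference_quotient.

Lemma lerB_swap (R : realDomainType) (a b c d : R) : (a - b <= c - d) = (d - b <= c - a).
Proof. by rewrite -subr_ge0 -[RHS]subr_ge0; congr (0 <= _); ring. Qed.

(** * Primitives, their level sets, and reflection of Lebesgue measure *)

Section lebesgue_primitive.
Variable R : realType.
Local Notation leb := (@lebesgue_measure R).
Implicit Types (g : R -> R) (a b t u : R).

Lemma lebesgue_itv_lty a b : (leb `[a, b]%classic < +oo)%E.
Proof. by rewrite lebesgue_measure_itv/=; case: ifP => _; rewrite -?EFinB ltry. Qed.

Lemma itv_subset_integrable g a b c d : a <= c -> d <= b ->
  leb.-integrable `[a, b] (EFin \o g) -> leb.-integrable `[c, d] (EFin \o g).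
Proof.
move=> ac db; apply: integrableS => // x /=; rewrite !in_itv/= => /andP[cx xd].
by rewrite (le_trans ac cx) (le_trans xd db).
Qed.

Lemma continuous_primitive g : (forall b, leb.-integrable `[0, b] (EFin \o g)) ->
  continuous (fun t => \int[leb]_(s in `[0, t]) g s).
Proof.
move=> ig t0.
(* Extending [g] by 0 to the left and integrating from [a] makes [t0] an interior point of the
   interval of integration, even when [t0 <= 0]. *)
pose a := Num.min t0 0 - 1.
have a0 : a < 0 by rewrite /a minEle; case: (leP t0 0) => h; lra.
have at0 : a < t0 by rewrite /a minEle; case: (leP t0 0) => h; lra.
pose h := g \_ `[0, +oo[.
have hE : (fun t => \int[leb]_(s in `[0, t]) g s) = (fun t => \int[leb]_(s in `[a, t]) h s).
  apply/funext => t; rewrite [LHS]Rintegral_mkcond [RHS]Rintegral_mkcond.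
  congr (Rintegral _ _ _); apply/funext => s; rewrite /h /patch !mem_setE !in_itv/= andbT.
  have [s0|s0] /= := leP 0 s; last by case: ifP.
  by rewrite (le_trans (ltW a0) s0).
rewrite hE.
have ih : leb.-integrable `[a, t0 + 1] (EFin \o h).
  have -> : EFin \o h = (EFin \o g) \_ `[0, +oo[ by rewrite /h restrict_EFin.
  apply/integrable_restrict => //.
  apply: integrableS (ig (t0 + 1)) => //; first exact: measurableI.
  by move=> x /= []; rewrite !in_itv/= andbT => /andP[_ ->] ->.
have at1 : a <= t0 + 1 by lra.
have := parameterized_integral_continuous at1 ih.
move=> /continuous_within_itvP; rewrite (_ : a < t0 + 1); last by lra.
case=> // + _ _; apply; rewrite in_itv/= at0; lra.
Qed.

(* [S] lies in [[a, d]] with [a], [d] in [S], and the integral of [g] over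
   [[a, d]] is [c - c]. *)
Lemma ae_level_set g b c :
  (forall x, 0 <= g x) -> measurable_fun setT g ->
  (forall b, leb.-integrable `[0, b] (EFin \o g)) ->
  {ae leb, forall s, 0 <= s <= b -> \int[leb]_(r in `[0, s]) g r = c -> g s = 0}.
Proof.
move=> g0 mg ig.
pose P t := \int[leb]_(s in `[0, t]) g s.
have cP : continuous P by exact: continuous_primitive.
pose S := `[0, b]%classic `&` P @^-1` [set c].
have clS : closed S.
  apply: closedI; first exact: interval_closed.
  by apply: preimage_closed => // x _; exact: cP.
have mS : measurable S by exact: closed_measurable.
have cS : compact S.
  by apply: (@subclosed_compact _ _ `[0, b]%classic) => //; [exact: segment_compact|move=> ? []].
have intS0 : (\int[leb]_(x in S) (g x)%:E = 0)%E.
  have [S0|/set0P S0] := eqVneq S set0; first by rewrite S0 integral_set0.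
  have cid : {within S, continuous (@id R)}.
    by apply: continuous_subspaceT => x; exact: cvg_id.
  have [d /set_mem[/= dI dc] dmax] := compact_EVT_max S0 cS cid.
  have cN : {within S, continuous (fun x : R => - x)}.
    by apply: continuous_subspaceT => x; apply: cvgN; exact: cvg_id.
  have [a /set_mem[/= aI ac] amin] := compact_EVT_max S0 cS cN.
  move: dI aI; rewrite !in_itv/= => /andP[d0 db] /andP[a0 ab].
  have ad : a <= d by apply: dmax; rewrite inE; split => //=; rewrite in_itv/= a0.
  apply/eqP; rewrite eq_le integral_ge0 ?andbT; last by move=> x _; rewrite lee_fin.
  apply: (@le_trans _ _ (\int[leb]_(x in `[a, d]) (g x)%:E)%E).
    apply: ge0_subset_integral => //.
    - by apply/measurable_EFinP; exact: measurable_funTS.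
    - by move=> x _; rewrite lee_fin.
    - move=> x Sx /=; rewrite in_itv/= -lerN2.
      by apply/andP; split; [apply: amin|apply: dmax]; rewrite inE.
  rewrite -integral_itv_obnd_cbnd; last first.
    by apply: measurable_funTS; apply/measurable_EFinP.
  have iad : leb.-integrable `]a, d] (EFin \o g).
    apply: integrableS (ig d) => // x /=; rewrite !in_itv/= => /andP[ax ->].
    by rewrite (le_trans a0 (ltW ax)).
  rewrite -(@fineK _ (\int[leb]_(x in _) _)%E); last exact: integrable_fin_num.
  rewrite lee_fin -[leLHS]/(\int[leb]_(x in `]a, d]) g x).
  rewrite -(@Rintegral_itvB _ g (BLeft 0) (BRight d))//.
  by move: ac dc; rewrite /P => -> ->; rewrite subrr.
have : ae_eq leb S (EFin \o g) (cst 0%E).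
  apply/ae_eq_integral_abs => //.
    by apply/measurable_EFinP; exact: measurable_funTS.
  rewrite -[RHS]intS0; apply: eq_integral => x _ /=.
  by rewrite ger0_norm.
apply: filterS => s h sb sc; move: h; rewrite /=.
have Ss : S s by split => //=; rewrite in_itv.
by move=> /(_ Ss) h; case: h.
Qed.

(** A named map, so that the structure of measurable function can be attached to it and the change
    of variables run through its image measure. *)
Definition reflect_at u : measurableTypeR R -> measurableTypeR R := fun x => u - x.

Lemma measurable_reflect_at u : measurable_fun setT (reflect_at u).
Proof. by apply: measurable_funB. Qed.

HB.instance Definition _ u :=
  isMeasurableFun.Build _ _ _ _ (reflect_at u) (measurable_reflect_at u).

(** By uniqueness, half-open intervals suffice. Reflection moves the closed end to the other side
    but keeps the length. *)
Lemma lebesgue_measure_reflect u (A : set R) : measurable A ->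
  pushforward leb (reflect_at u) A = leb A.
Proof.
move=> mA; apply/esym/lebesgue_measure_unique => //= _ [[a b]] _ <-.
rewrite /pushforward/= (_ : _ @^-1` _ = `[u - b, u - a[%classic); last first.
  by apply/seteqP; split => x /=; rewrite /reflect_at !in_itv/= => /andP[h1 h2];
    apply/andP; split; lra.
rewrite !lebesgue_measure_itv/= !lte_fin ltrD2l ltrN2; case: ifP => // _.
by rewrite -!EFinB; congr (_%:E); ring.
Qed.

Lemma ge0_integral_reflect u (g : R -> \bar R) (D : set R) : measurable D ->
  measurable_fun setT g -> (forall x, 0 <= g x)%E ->
  (\int[leb]_(x in reflect_at u @^-1` D) g (u - x)%R = \int[leb]_(x in D) g x)%E.
Proof.
move=> mD mg g0.
rewrite -[LHS](ge0_integral_pushforward (measurable_reflect_at u) leb) //; last exact: measurable_funTS.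
apply: eq_measure_integral => A mA _; exact: lebesgue_measure_reflect.
Qed.

Lemma ge0_integral_reflect_itv u a b (g : R -> R) :
  measurable_fun setT g -> (forall x, 0 <= g x) ->
  (\int[leb]_(x in `[a, b]) (g (u - x)%R)%:E = \int[leb]_(x in `[(u - b)%R, (u - a)%R]) (g x)%:E)%E.
Proof.
move=> mg g0; rewrite -(@ge0_integral_reflect u (EFin \o g))//.
- congr (integral _ _ _); apply/seteqP; split => x /=;
  by rewrite /reflect_at !in_itv/= => /andP[h1 h2]; apply/andP; split; lra.
- exact/measurable_EFinP.
Qed.

End lebesgue_primitive.

(** * The abandonment kernel *)

Section kernel.
Variables (R : realType) (F lam : R -> R) (om L : R).
Local Notation leb := (@lebesgue_measure R).
Local Notation mR := (measurableTypeR R).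
Hypothesis cF : continuous F.
Hypothesis F01 : forall x, 0 <= F x <= 1.
Hypothesis f_bound : forall x, 0 <= derive1 F x <= L.
Hypothesis f_sat : forall x, F x = 1 -> derive1 F x = 0.
Hypothesis lam_ge0 : forall x, 0 <= lam x.
Hypothesis mlam : measurable_fun setT lam.
Hypothesis ilam : forall a b, leb.-integrable `[a, b] (EFin \o lam).

Let f := derive1 F.
Let f0 x : 0 <= f x. Proof. by have /andP[] := f_bound x. Qed.
Let fL x : f x <= L. Proof. by have /andP[] := f_bound x. Qed.
Let L0 : 0 <= L. Proof. exact: le_trans (f0 0) (fL 0). Qed.
Let Fc0 x : 0 <= 1 - F x. Proof. by have := F01 x; lra. Qed.
Let Fc1 x : 1 - F x <= 1. Proof. by have := F01 x; lra. Qed.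
Let mf : measurable_fun setT f. Proof. exact: derive1_measurable. Qed.

Let mlam_sub d (T : measurableType d) (a b : T -> mR) : measurable_fun setT a ->
  measurable_fun setT b -> measurable_fun setT (fun z => lam (a z - b z)).
Proof.
by move=> ma mb; apply: (measurableT_comp mlam); apply: measurable_funB.
Qed.

Let mFc : measurable_fun setT (fun x => 1 - F x).
Proof. by apply: measurable_funB => //; exact: continuous_measurable_fun. Qed.

Let ireflect u a b : leb.-integrable `[a, b] (EFin \o (fun s => lam (u - s))).
Proof.
apply/integrableP; split.
  by apply/measurable_EFinP; apply: measurable_funTS; exact: mlam_sub.
rewrite (_ : (\int[leb]_(x in _) _ = \int[leb]_(x in `[(u - b)%R, (u - a)%R]) (lam x)%:E)%E).
  rewrite (_ : (\int[leb]_(x in _) _ = \int[leb]_(x in `[(u - b)%R, (u - a)%R]) `|(lam x)%:E|)%E).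
    by have /integrableP[] := ilam (u - b) (u - a).
  by apply: eq_integral => x _; rewrite gee0_abs// lee_fin.
rewrite -ge0_integral_reflect_itv//; apply: eq_integral => x _ /=.
by rewrite ger0_norm.
Qed.

Let int_reflect u : \int[leb]_(s in `[0, u + om]) lam (u - s) = \int[leb]_(s in `[- om, u]) lam s.
Proof.
rewrite /Rintegral ge0_integral_reflect_itv//.
by rewrite subr0 opprD addNKr.
Qed.

Let idom (c : R) (g : R -> R) u b : measurable_fun setT g ->
  (forall s, `|g s| <= c * lam (u - s)) -> leb.-integrable `[0, b] (EFin \o g).
Proof.
move=> mg gc.
apply: (@le_integrable _ _ _ leb _ _ _ (EFin \o (fun s => c * lam (u - s)))) => //.
- by apply/measurable_EFinP; exact: measurable_funTS.
- by move=> s _ /=; rewrite lee_fin (le_trans (gc s))// ler_norm.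
- by apply: integrable_scale => //; exact: ireflect.
Qed.

Let g u s := (1 - F s) * lam (u - s).

Let g0 u s : 0 <= g u s. Proof. exact: mulr_ge0. Qed.

Let mg u : measurable_fun setT (g u).
Proof. by apply: measurable_funM => //; exact: mlam_sub. Qed.

Let ig u b : leb.-integrable `[0, b] (EFin \o g u).
Proof.
apply: (idom (c := 1) (u := u)) => // s.
by rewrite ger0_norm// mul1r /g ler_piMl.
Qed.

Lemma Fd_ge0 u s : 0 <= Fd F lam u s.
Proof. by apply: Rintegral_ge0 => r _; exact: g0. Qed.

Lemma Fd_nondecreasing u s s' : s <= s' -> Fd F lam u s <= Fd F lam u s'.
Proof.
move=> ss'; rewrite /Fd fine_le//; [exact/integrable_fin_num/ig|exact/integrable_fin_num/ig|].
apply: ge0_subset_integral => //.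
- by apply: measurable_funTS; apply/measurable_EFinP; exact: mg.
- by move=> r _; rewrite lee_fin; exact: g0.
- by move=> r /=; rewrite !in_itv/= => /andP[-> rs]; exact: le_trans ss'.
Qed.

(** Moving the variable domain of integration into the integrand as a condition turns [Fd] into a
    partial integral of a jointly measurable function, to which Tonelli applies. *)
Lemma measurable_Fd : measurable_fun setT (fun z : mR * mR => Fd F lam z.1 z.2).
Proof.
pose h (z : (mR * mR) * mR) : \bar R :=
  (if (0 <= z.2) && (z.2 <= z.1.2) then g z.1.1 z.2 else 0)%:E.
have mh : measurable_fun setT h.
  apply/measurable_EFinP; apply: measurable_fun_ifT => //.
    by apply: measurable_and; apply: measurable_fun_ler => //;
      apply: measurableT_comp.
  apply: measurable_funM; first exact: (measurableT_comp mFc).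
  by apply: mlam_sub => //; apply: measurableT_comp.
have h0 z : (0 <= h z)%E by rewrite /h; case: ifP => // _; rewrite lee_fin g0.
have -> : (fun z : mR * mR => Fd F lam z.1 z.2) = fine \o fubini_F leb h.
  apply/funext => z; rewrite /Fd /Rintegral /= /fubini_F [X in fine X = _]integral_mkcond.
  congr fine. apply: eq_integral => s _.
  by rewrite /h/= /patch mem_setE in_itv/=; case: ifP.
by apply: measurableT_comp => //; exact: measurable_fun_fubini_tonelli_F.
Qed.

(** For [psi] the indicator of the positive half-line this is the abandonment rate [K_u(y)];
    Lipschitz [psi] give its regularisations. *)
Definition kern (psi : R -> R) (u y : R) :=
  \int[leb]_(s in `[0, u + om]) (f s * lam (u - s) * psi (y - Fd F lam u s)).

Definition smoothing (psi : R -> R) :=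
  measurable_fun setT psi /\ forall x, 0 <= psi x <= 1.

Let mkern psi u y : measurable_fun setT psi ->
  measurable_fun setT (fun s => f s * lam (u - s) * psi (y - Fd F lam u s)).
Proof.
move=> mpsi; apply: measurable_funM.
  by apply: measurable_funM => //; exact: mlam_sub.
apply: (measurableT_comp mpsi); apply: measurable_funB => //.
exact: (measurableT_comp measurable_Fd (pair1_measurable u)).
Qed.

Let ikern psi u y b : smoothing psi -> leb.-integrable `[0, b]
  (EFin \o (fun s => f s * lam (u - s) * psi (y - Fd F lam u s))).
Proof.
move=> [mpsi psi01]; apply: (idom (c := L) (u := u)) => //; first exact: mkern.
move=> s; have /andP[p0 p1] := psi01 (y - Fd F lam u s).
rewrite ger0_norm; last by rewrite !mulr_ge0.
by rewrite (@le_trans _ _ (f s * lam (u - s)))// ?ler_wpM2r// ler_piMr// mulr_ge0.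
Qed.

Definition kern_bound T := L * \int[leb]_(s in `[- om, T]) lam s.

Lemma kern_bound_ge0 T : 0 <= kern_bound T.
Proof. by rewrite mulr_ge0// Rintegral_ge0. Qed.

Lemma kern_bounds psi u y T : smoothing psi -> u <= T -> 0 <= kern psi u y <= kern_bound T.
Proof.
move=> sp uT; have [mpsi psi01] := sp; apply/andP; split.
  apply: Rintegral_ge0 => s _; have /andP[p0 p1] := psi01 (y - Fd F lam u s).
  by rewrite !mulr_ge0.
apply: (@le_trans _ _ (L * \int[leb]_(s in `[0, u + om]) lam (u - s))).
  rewrite -RintegralZl//.
  apply: le_Rintegral => //; first exact: ikern.
    by apply: integrable_scale => //; exact: ireflect.
  move=> s _; have /andP[p0 p1] := psi01 (y - Fd F lam u s).
  by rewrite (@le_trans _ _ (f s * lam (u - s)))// ?ler_wpM2r// ler_piMr// mulr_ge0.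
rewrite int_reflect ler_wpM2l// /Rintegral fine_le//;
  [exact/integrable_fin_num/ilam|exact/integrable_fin_num/ilam|].
apply: ge0_subset_integral => //.
- by apply: measurable_funTS; apply/measurable_EFinP.
- by move=> r _; rewrite lee_fin.
- by move=> r /=; rewrite !in_itv/= => /andP[-> ru]; exact: le_trans uT.
Qed.

Lemma kern_le psi1 psi2 u y1 y2 : smoothing psi1 -> smoothing psi2 ->
  (forall v, 0 <= v -> psi1 (y1 - v) <= psi2 (y2 - v)) ->
  kern psi1 u y1 <= kern psi2 u y2.
Proof.
move=> sp1 sp2 h; apply: le_Rintegral => //; [exact: ikern|exact: ikern|].
move=> s _; rewrite ler_wpM2l// ?mulr_ge0//.
by apply: h; exact: Fd_ge0.
Qed.

Lemma kern0 psi u : (forall x, x <= 0 -> psi x = 0) -> kern psi u 0 = 0.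
Proof.
move=> h; rewrite /kern /Rintegral integral0_eq// => s _.
by rewrite h ?mulr0// sub0r oppr_le0 Fd_ge0.
Qed.

Lemma kern_lip psi n u y1 y2 T : smoothing psi -> u <= T ->
  (forall a b, `|psi a - psi b| <= n * `|a - b|) ->
  `|kern psi u y1 - kern psi u y2| <= n * kern_bound T * `|y1 - y2|.
Proof.
move=> sp uT psin.
have n0 : 0 <= n by have := psin 1 0; rewrite subr0 normr1 mulr1; apply: le_trans.
have one : smoothing (cst 1) by split => //= x; rewrite ler01 lexx.
rewrite /kern -RintegralB//; [|exact: ikern|exact: ikern].
apply: (le_trans (le_normr_Rintegral _ _)) => //.
  by apply: integrable_sub => //; exact: ikern.
(* With [psi] constant equal to 1, [kern] is the full integral of [f s * lam (u - s)], whatever its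
   last argument. *)
apply: (@le_trans _ _ (n * `|y1 - y2| * kern (cst 1) u 0)); last first.
  rewrite mulrAC ler_wpM2r// ler_wpM2l//.
  by have /andP[] := kern_bounds 0 one uT.
rewrite /kern -RintegralZl//; last exact: ikern.
apply: le_Rintegral => //.
- apply: (@integrable_norm _ _ _ leb `[0, u + om]%classic (fun s => f s * lam (u - s) * psi (y1 - Fd F lam u s) - f s * lam (u - s) * psi (y2 - Fd F lam u s))) => //.
  by apply: integrable_sub => //; exact: ikern.
- by apply: integrable_scale => //; exact: ikern.
- move=> s _; rewrite -mulrBr normrM mulr1 ger0_norm ?mulr_ge0//.
  rewrite [leRHS]mulrC ler_wpM2l ?mulr_ge0//; apply: (le_trans (psin _ _)).
  by rewrite (_ : y1 - _ - (y2 - _) = y1 - y2)//; ring.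
Qed.

Lemma kern_measurable psi (q : R -> R) : smoothing psi -> measurable_fun setT q ->
  measurable_fun setT (fun u => kern psi u (q u)).
Proof.
move=> [mpsi psi01] mq.
pose h (z : mR * mR) : \bar R := (if (0 <= z.2) && (z.2 <= z.1 + om) then
  f z.2 * lam (z.1 - z.2) * psi (q z.1 - Fd F lam z.1 z.2) else 0)%:E.
have mh : measurable_fun setT h.
  apply/measurable_EFinP; apply: measurable_fun_ifT => //.
    apply: measurable_and; apply: measurable_fun_ler => //.
    by apply: measurable_funD.
  apply: measurable_funM.
    by apply: measurable_funM; [exact: (measurableT_comp mf)|exact: mlam_sub].
  apply: (measurableT_comp mpsi); apply: measurable_funB; last exact: measurable_Fd.
  exact: (measurableT_comp mq).
have h0 z : (0 <= h z)%E.
  rewrite /h; case: ifP => // _.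
  by have /andP[p0 _] := psi01 (q z.1 - Fd F lam z.1 z.2); rewrite lee_fin !mulr_ge0.
have -> : (fun u => kern psi u (q u)) = fine \o fubini_F leb h.
  apply/funext => u; rewrite /kern /Rintegral /= /fubini_F [X in fine X = _]integral_mkcond.
  congr fine; apply: eq_integral => s _.
  by rewrite /h/= /patch mem_setE in_itv/=; case: ifP.
by apply: measurableT_comp => //; exact: measurable_fun_fubini_tonelli_F.
Qed.

(** [ae_level_set] gives [(1 - F s) * lam (u - s) = 0] almost everywhere on the level set. Either
    the second factor vanishes, or [F s = 1] and then [f s = 0] by [f_sat]. *)
Lemma kern_level u c b :
  {ae leb, forall s, 0 <= s <= b -> Fd F lam u s = c -> f s * lam (u - s) = 0}.
Proof.
have [N [mN N0 sN]] := @ae_level_set _ (g u) b c (g0 u) (mg u) (ig u).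
exists N; split => // s /= hs; apply: sN => /= h; apply: hs => sb sc.
have := h sb sc; rewrite /g => /eqP; rewrite mulf_eq0 => /orP[|/eqP ->]; last by rewrite mulr0.
rewrite subr_eq0 eq_sym => /eqP F1.
by rewrite /f f_sat// mul0r.
Qed.

(** Convergence at [v = y] is not asked for: the points [s] with [Fd F lam u s = y] form a level
    set, where the integrand vanishes almost everywhere by [kern_level]. *)
Lemma kern_cvg (psin : nat -> R -> R) psi (y_ : nat -> R) y u :
  (forall n, smoothing (psin n)) -> smoothing psi ->
  (forall v, v != y -> psin n (y_ n - v) @[n --> \oo] --> psi (y - v)) ->
  kern (psin n) u (y_ n) @[n --> \oo] --> kern psi u y.
Proof.
move=> spn sp psicv.
apply: fine_cvg; rewrite fineK; last exact/integrable_fin_num/ikern.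
have := @dominated_convergence _ _ _ leb `[0, u + om]%classic (measurable_itv _)
  (fun n s => (f s * lam (u - s) * psin n (y_ n - Fd F lam u s))%:E)
  (fun s => (f s * lam (u - s) * psi (y - Fd F lam u s))%:E)
  (EFin \o (fun s => L * lam (u - s))).
case=> //.
- by move=> n; apply/measurable_EFinP; apply: measurable_funTS; apply: mkern; case: (spn n).
- by apply/measurable_EFinP; apply: measurable_funTS; apply: mkern; case: sp.
- have [N [mN N0 sN]] := kern_level u y (u + om).
  exists N; split => // s /= hs; apply: sN => /= h; apply: hs.
  rewrite in_itv/= => su; apply: cvg_EFin; first by near=> n.
  have [sy|sy] := eqVneq (Fd F lam u s) y.
    rewrite (h su sy) mul0r.
    by under eq_cvg do rewrite /= mul0r; exact: cvg_cst.
  by apply: cvgM; [exact: cvg_cst|exact: psicv].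
- by apply: integrable_scale => //; exact: ireflect.
- apply: aeW => s n _ /=; rewrite lee_fin.
  have [_ psi01] := spn n; have /andP[p0 p1] := psi01 (y_ n - Fd F lam u s).
  rewrite ger0_norm; last by rewrite !mulr_ge0.
  by rewrite (@le_trans _ _ (f s * lam (u - s)))// ?ler_wpM2r// ler_piMr// mulr_ge0.
Unshelve. all: by end_near. Qed.

(** * The memory: cumulative abandonment along a path *)

Let K := kern.
Let B := kern_bound.
Let Kb psi (u y T : R) : smoothing psi -> u <= T -> 0 <= K psi u y <= B T.
Proof. by move=> sp uT; exact: kern_bounds. Qed.
Let B0 T : 0 <= B T. Proof. exact: kern_bound_ge0. Qed.

Definition memory (psi : R -> R) (X : R -> R) (t : R) :=
  \int[leb]_(u in `[0, t]) K psi u (excess (X u)).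

Let mK psi X : smoothing psi -> continuous X ->
  measurable_fun setT (fun u => K psi u (excess (X u))).
Proof.
move=> sp cX; apply: kern_measurable => //.
by apply: continuous_measurable_fun; exact: continuous_excess.
Qed.

Lemma memory_integrable psi X t : smoothing psi -> continuous X ->
  leb.-integrable `[0, t] (EFin \o (fun u => K psi u (excess (X u)))).
Proof.
move=> sp cX; apply: (@integrable_of_bound _ _ _ _ _ _ (B t)) => //.
- exact: lebesgue_itv_lty.
- by apply: measurable_funTS; exact: mK.
- move=> u /=; rewrite in_itv/= => /andP[_ ut].
  by have /andP[k0 k1] := Kb (excess (X u)) sp ut; rewrite ger0_norm.
Qed.

Lemma memory_continuous psi X : smoothing psi -> continuous X ->
  continuous (memory psi X).
Proof.
by move=> sp cX; apply: continuous_primitive => b; exact: memory_integrable.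
Qed.

Lemma memory0 psi X : memory psi X 0 = 0.
Proof. by rewrite /memory set_itv1 Rintegral_set1. Qed.

Let int_expR (al t : R) : 0 < al -> 0 <= t ->
  \int[leb]_(u in `[0, t]) expR (al * u) <= expR (al * t) / al.
Proof.
move=> al0; rewrite le_eqVlt => /predU1P[<-|t0].
  by rewrite set_itv1 Rintegral_set1 divr_ge0 ?expR_ge0// ltW.
pose E u := expR (al * u) / al.
have dE (u : R) : is_derive u (1 : R) E (expR (al * u)).
  rewrite /E; apply: is_derive_eq.
  by rewrite /GRing.scale/=; field; rewrite gt_eqF.
have cE : continuous E.
  by move=> u; apply: differentiable_continuous; apply/derivable1_diffP; exact: ex_derive.
have ce : continuous (fun u => expR (al * u)).
  move=> u; apply: (@continuous_comp _ _ _ (fun u => al * u) (@expR R)); last exact: continuous_expR.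
  by apply: cvgM; [exact: cvg_cst|exact: cvg_id].
rewrite /Rintegral (@continuous_FTC2 _ _ E)//=.
- by rewrite gerBl /E divr_ge0 ?expR_ge0// ltW.
- exact: continuous_subspaceT.
- split; first by move=> u _; exact: ex_derive.
    by apply: cvg_at_right_filter; exact: cE.
  by apply: cvg_at_left_filter; exact: cE.
- by move=> u _; rewrite derive1E; exact: derive_val.
Qed.

Lemma memory_lipschitz psi (n : R) : smoothing psi ->
  (forall a b, `|psi a - psi b| <= n * `|a - b|) -> lipschitz_memory (memory psi).
Proof.
move=> sp psin T T0.
have n0 : 0 <= n by have := psin 1 0; rewrite subr0 normr1 mulr1; apply: le_trans.
exists (n * B T); first by rewrite mulr_ge0.
move=> X Y cX cY al M al0 M0 XY t /andP[t0 tT].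
have iX := memory_integrable t sp cX; have iY := memory_integrable t sp cY.
rewrite /memory -RintegralB//.
apply: (le_trans (le_normr_Rintegral _ _)) => //; first exact: integrable_sub.
have ce : continuous (fun u => expR (al * u)).
  move=> u; apply: (@continuous_comp _ _ _ (fun u => al * u) (@expR R)); last exact: continuous_expR.
  by apply: cvgM; [exact: cvg_cst|exact: cvg_id].
have ie : leb.-integrable `[0, t] (EFin \o (fun u => expR (al * u))).
  apply: continuous_compact_integrable; first exact: segment_compact.
  exact: continuous_subspaceT.
apply: (@le_trans _ _ (n * B T * M * \int[leb]_(u in `[0, t]) expR (al * u))); last first.
  rewrite (_ : n * B T / al * M * expR (al * t) = n * B T * M * (expR (al * t) / al)); last by ring.
  apply: ler_wpM2l; last exact: int_expR.
  by apply: mulr_ge0 => //; apply: mulr_ge0 => //; exact: B0.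
rewrite -RintegralZl//; apply: le_Rintegral => //.
- apply: (integrable_norm (integrable_sub _ iX iY)) => //.
- exact: integrable_scale.
move=> u /=; rewrite in_itv/= => /andP[u0 ut].
have uT := le_trans ut tT.
apply: (le_trans (kern_lip _ _ sp uT psin)).
rewrite -[leRHS]mulrA; apply: ler_wpM2l; first by apply: mulr_ge0 => //; exact: B0.
by apply: (le_trans (excess_lip _ _)); apply: XY; rewrite u0.
Qed.

(** Pointwise in [u], either the excesses are [rho] apart and [psi12] orders the integrands of the
    two kernels, or [X2 u < 1] and the second kernel is 0, as [psi2] vanishes on nonpositive
    arguments. *)
Lemma memory_order psi1 psi2 X1 X2 rho T : smoothing psi1 -> smoothing psi2 ->
  continuous X1 -> continuous X2 ->
  (forall x, x <= 0 -> psi2 x = 0) ->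
  (forall x y, x + rho <= y -> psi2 x <= psi1 y) ->
  order_cond T rho X1 X2 (memory psi1 X1) (memory psi2 X2).
Proof.
move=> sp1 sp2 cX1 cX2 psi0 psi12 s t s0 st tT h.
have split_memory psi X : smoothing psi -> continuous X ->
    memory psi X t - memory psi X s = \int[leb]_(u in `]s, t]) K psi u (excess (X u)).
  move=> sp cX; rewrite /memory.
  rewrite (@Rintegral_itvB _ (fun u => K psi u (excess (X u))) (BLeft 0) (BRight t))//.
  exact: memory_integrable.
rewrite lerB_swap.
have sub psi X : smoothing psi -> continuous X ->
    leb.-integrable `]s, t] (EFin \o (fun u => K psi u (excess (X u)))).
  move=> sp cX; apply: integrableS (memory_integrable t sp cX) => // u /=.
  by rewrite !in_itv/= => /andP[su ->]; rewrite (le_trans s0 (ltW su)).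
rewrite !split_memory//; apply: le_Rintegral => //; [exact: sub|exact: sub|].
move=> u /=; rewrite in_itv/= => /andP[su ut].
have [q12|X21] := h u su ut.
  apply: kern_le => // v v0.
  by apply: psi12; lra.
have -> : excess (X2 u) = 0 by rewrite /excess max_r//; lra.
rewrite /K kern0//.
by have /andP[] := Kb (excess (X1 u)) sp1 (lexx u).
Qed.

Lemma memory_cvg (psin : nat -> R -> R) psi (Xn : nat -> R -> R) X T :
  (forall n, smoothing (psin n)) -> smoothing psi ->
  (forall (y_ : nat -> R) y v, y_ n @[n --> \oo] --> y -> v != y ->
     psin n (y_ n - v) @[n --> \oo] --> psi (y - v)) ->
  (forall n, continuous (Xn n)) -> continuous X ->
  (forall t, 0 <= t -> Xn n t @[n --> \oo] --> X t) ->
  exists e : nat -> R, e @ \oo --> 0 /\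
    forall n t, 0 <= t <= T -> `|memory (psin n) (Xn n) t - memory psi X t| <= e n.
Proof.
move=> spn sp psicv cXn cX XnX.
pose k n u := K (psin n) u (excess (Xn n u)).
pose k0 u := K psi u (excess (X u)).
have ikn n t : leb.-integrable `[0, t] (EFin \o k n) by exact: memory_integrable.
have ik0 t : leb.-integrable `[0, t] (EFin \o k0) by exact: memory_integrable.
have id n t : leb.-integrable `[0, t] (EFin \o (fun u => k n u - k0 u)).
  exact: integrable_sub.
have idn n t : leb.-integrable `[0, t] (EFin \o (fun u => `|k n u - k0 u|)).
  exact: (integrable_norm (id n t)).
(* Integrating the absolute value over all of [[0, T]] gives one bound for every [t], so pointwise
   convergence of the kernels yields uniform convergence of the memories. *)
exists (fun n => \int[leb]_(u in `[0, T]) `|k n u - k0 u|); split; last first.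
  move=> n t /andP[t0 tT].
  rewrite /memory -(RintegralB _ (ikn n t) (ik0 t))//.
  apply: (le_trans (le_normr_Rintegral _ (id n t))) => //.
  rewrite /Rintegral fine_le//; try exact/integrable_fin_num/idn.
  apply: ge0_subset_integral => //.
    by have /integrableP[] := idn n T.
  by move=> u /=; rewrite !in_itv/= => /andP[-> ut]; exact: le_trans tT.
have := @dominated_convergence _ _ _ leb `[0, T]%classic (measurable_itv _)
  (fun n => EFin \o k n) (EFin \o k0) (EFin \o cst (B T)).
case.
- by move=> n; have /integrableP[] := ikn n T.
- by have /integrableP[] := ik0 T.
- apply: aeW => u /=; rewrite in_itv/= => /andP[u0 _].
  apply: cvg_EFin; first by near=> n.
  apply: kern_cvg => // v vy.
  apply: psicv => //.
  apply: (@continuous_cvg _ _ _ _ _ (fun n => Xn n u) (@excess R)).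
    by apply: continuous_maxl => x; apply: cvgB; [exact: cvg_id|exact: cvg_cst].
  exact: XnX.
- by apply: (@integrable_of_bound _ _ _ _ _ _ `|B T|) => //; exact: lebesgue_itv_lty.
- apply: aeW => u n /=; rewrite in_itv/= => /andP[_ uT].
  by rewrite lee_fin; have /andP[? ?] := Kb (excess (Xn n u)) (spn n) uT; rewrite ger0_norm.
move=> _ + _ => /fine_cvg; apply: cvg_trans; apply: near_eq_cvg; near=> n.
by [].
Unshelve. all: by end_near. Qed.

(** The ramp rises to the right of 0, so an empty queue still loses nothing; its width [1 / (n + 1)]
    is the tolerance of the order conditions. *)
Definition ramp (n : nat) (x : R) := Num.min (Num.max (n.+1%:R * x) 0) 1.
Definition step (x : R) : R := if 0 < x then 1 else 0.

Lemma smoothing_ramp n : smoothing (ramp n).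
Proof.
split.
  by apply: measurable_minr => //; apply: measurable_maxr => //; apply: measurable_funM.
by move=> x; rewrite /ramp le_min ler01 le_max lexx orbT/= ge_min lexx orbT.
Qed.

Lemma smoothing_step : smoothing step.
Proof.
split; last by move=> x; rewrite /step; case: ifP; rewrite ?ler01 lexx.
by apply: measurable_fun_ifT => //; apply: measurable_fun_ltr.
Qed.

Lemma ramp_le0 n x : x <= 0 -> ramp n x = 0.
Proof.
move=> x0; rewrite /ramp max_r ?min_l ?ler01//.
by rewrite mulr_ge0_le0.
Qed.

Lemma step_le0 x : x <= 0 -> step x = 0.
Proof. by rewrite /step ltNge => ->. Qed.

Lemma ramp_eq1 n x : n.+1%:R^-1 <= x -> ramp n x = 1.
Proof.
move=> nx; rewrite /ramp min_r// le_max; apply/orP; left.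
by rewrite -ler_pdivrMl// mulr1.
Qed.

Lemma ramp_lip n a b : `|ramp n a - ramp n b| <= n.+1%:R * `|a - b|.
Proof.
rewrite -[n.+1%:R in leRHS]ger0_norm// -normrM mulrBr /ramp.
move: (n.+1%:R * a) (n.+1%:R * b) => x y.
have maxlip : `|Num.max x 0 - Num.max y 0| <= `|x - y|.
  have := excess_lip (x + 1) (y + 1); rewrite /excess !addrK.
  by rewrite (_ : x + 1 - (y + 1) = x - y)//; ring.
apply: le_trans maxlip; move: (Num.max x 0) (Num.max y 0) => p q.
rewrite !minEle ler_norml; have := ler_norm (p - q); have := ler_norm (- (p - q)).
rewrite normrN; case: (leP p 1) => hp; case: (leP q 1) => hq h1 h2; apply/andP; split; lra.
Qed.

(** At [v = y] the claim fails in general: [y_ n - y] may shrink as fast as the width of the ramp,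
    leaving intermediate values. Away from it the ramp is eventually constant along the sequence. *)
Lemma ramp_cvg (y_ : nat -> R) y v : y_ n @[n --> \oo] --> y -> v != y ->
  ramp n (y_ n - v) @[n --> \oo] --> step (y - v).
Proof.
move=> /cvgrPdist_lt yy vy; have [yv|yv] := ltP v y.
  have e0 : 0 < (y - v) / 2 by lra.
  rewrite /step subr_gt0 yv; apply: (@cvg_trans _ ((cst 1 : nat -> R) n @[n --> \oo])); last exact: cvg_cst.
  apply: near_eq_cvg; near=> n; rewrite /= ramp_eq1//.
  have h1 : n.+1%:R^-1 < (y - v) / 2.
    by near: n; exact: (near_infty_natSinv_lt (PosNum e0)).
  have : `|y - y_ n| < (y - v) / 2 by near: n; exact: yy.
  rewrite ltr_norml => /andP[h2 h3]; have : (y - v) / 2 <= y_ n - v by lra.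
  by apply: le_trans; exact: ltW.
have {}yv : y < v by rewrite lt_neqAle eq_sym vy.
have e0 : 0 < (v - y) / 2 by lra.
rewrite step_le0; last by lra.
apply: (@cvg_trans _ ((cst 0 : nat -> R) n @[n --> \oo])); last exact: cvg_cst.
apply: near_eq_cvg; near=> n; rewrite /= ramp_le0//.
have : `|y - y_ n| < (v - y) / 2 by near: n; exact: yy.
by rewrite ltr_norml => /andP[h2 h3]; lra.
Unshelve. all: by end_near. Qed.


(** * Identification of [H] with the kernel of the step function *)

Let Fdinv_itv u y : 0 <= u + om -> 0 <= Fdinv F lam om u y <= u + om.
Proof.
move=> uom; rewrite /Fdinv; set S := [set x | _].
have lb0 : lbound S 0 by move=> x [/andP[]].
have [->|/set0P[x Sx]] := eqVneq S set0; first by rewrite inf0 lexx.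
apply/andP; split; first by apply: lb_le_inf => //; exists x.
have [/andP[_ xu] _] := Sx; apply: le_trans xu.
by apply: ge_inf => //; exists 0.
Qed.

(* For [s < Fdinv u z] the integrand is cut at neither side; beyond, the
   indicator can only survive where [Fd u] has reached its maximum [NF u],
   and there [f * lam] vanishes almost everywhere. *)
Let kern_Ft u y z : 0 <= u + om -> z = Num.min y (NF F lam om u) ->
  kern step u y = Ft F lam u (Fdinv F lam om u z).
Proof.
move=> uom zE; have /andP[x0 xu] := Fdinv_itv z uom.
move: x0 xu; set x0 := Fdinv F lam om u z => x00 x0u.
pose S := [set x | 0 <= x <= u + om /\ z <= Fd F lam u x].
have lb0 : has_lbound S by exists 0 => x [/andP[]].
have zy : z <= y by rewrite zE ge_min lexx.
have zN : z <= NF F lam om u by rewrite zE ge_min lexx orbT.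
(* The cap of [z] at [NF] puts [u + om] in [S], so the infimum is genuine and not the default value
   0. *)
have S0 : S !=set0 by exists (u + om); split => //; rewrite uom lexx.
have -> : Ft F lam u x0 =
    \int[leb]_(s in `[0, u + om]) (if s <= x0 then f s * lam (u - s) else 0).
  rewrite /Ft Rintegral_mkcond [RHS]Rintegral_mkcond; congr (Rintegral _ _ _).
  apply/funext => s; rewrite /patch !mem_setE !in_itv/=.
  have [s0|s0] //= := leP 0 s; case: (leP s x0) => sx; last by case: ifP.
  by rewrite (le_trans sx x0u).
rewrite /kern /Rintegral; congr fine; apply: ae_eq_integral => //.
- apply/measurable_EFinP; apply: measurable_funTS; apply: mkern.
  by case: smoothing_step.
- apply/measurable_EFinP; apply: measurable_funTS; apply: measurable_fun_ifT => //.
    exact: measurable_fun_ler.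
  by apply: measurable_funM => //; exact: mlam_sub.
have [N [mN N0 sN]] := kern_level u (NF F lam om u) (u + om).
exists (N `|` [set x0]); split.
- by apply: measurableU.
- by apply: null_set_setU => //; exact: lebesgue_measure_set1.
move=> s /= hs; apply: contrapT => /not_orP[Ns sx0].
apply: hs; rewrite in_itv/= => su; congr (_%:E).
have lev : Fd F lam u s = NF F lam om u -> f s * lam (u - s) = 0.
  by have : ~ ~ (0 <= s <= u + om -> Fd F lam u s = NF F lam om u -> f s * lam (u - s) = 0);
    [move=> h; apply: Ns; exact: sN|move/contrapT; exact].
have /andP[s0 su'] := su.
case: (ltgtP s x0) => [sx|xs|//].
- have : Fd F lam u s < z.
    rewrite ltNge; apply/negP => zs.
    have : x0 <= s by apply: ge_inf.
    by rewrite leNgt sx.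
  by move=> sz; rewrite /step ifT ?mulr1// subr_gt0; exact: lt_le_trans zy.
- have [x Sx xs'] : exists2 x, S x & x < s.
    by have [x Sx] := inf_adherent (ltac:(by rewrite subr_gt0; exact: xs) : 0 < s - x0) (conj S0 lb0);
      rewrite -/(Fdinv F lam om u z) -/x0 subrKC => ?; exists x.
  have zs : z <= Fd F lam u s.
    by case: Sx => _ zx; apply: (le_trans zx); apply: Fd_nondecreasing; exact: ltW.
  have sN' : Fd F lam u s <= NF F lam om u by exact: Fd_nondecreasing.
  have [ys|sy] := leP y (Fd F lam u s).
    by rewrite step_le0 ?mulr0// subr_le0.
  have : z = NF F lam om u.
    by move: zs; rewrite zE minEle; case: ifP => // yN; rewrite leNgt sy.
  by move=> zN'; rewrite lev ?mul0r//; apply/le_anti; rewrite sN' -zN'.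
Qed.

(** Both branches of [H] evaluate the inverse at the minimum of [y] and [NF], which is the form
    treated by [kern_Ft]. *)
Lemma H_kern u y : 0 <= u + om -> H F lam om u y = lam u - kern step u y.
Proof.
move=> uom; rewrite /H; case: ifPn => [yN|].
  by rewrite (kern_Ft uom (z := y))// min_l// ltW.
by rewrite -leNgt => Ny; rewrite (kern_Ft uom (z := NF F lam om u))// min_r.
Qed.

End kernel.

Arguments step {R} x.
Arguments ramp {R} n x.

(** * Integration against the equilibrium distribution *)

Section density.
Variable R : realType.
Local Notation leb := (@lebesgue_measure R).
Local Notation mR := (measurableTypeR R).

(* Layer cake: [phi x] is the length of [[0, phi x[], so both sides are the
   integral over [y] of the measure of [phi > y]. *)
Lemma ge0_integral_density (nu : {sigma_finite_measure set mR -> \bar R})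
    (k phi : mR -> R) :
  (forall x, 0 <= k x) -> measurable_fun setT k ->
  (forall A, measurable A -> nu A = \int[leb]_(x in A) (k x)%:E)%E ->
  (forall x, 0 <= phi x) -> measurable_fun setT phi ->
  (\int[nu]_x (phi x)%:E = \int[leb]_x (phi x * k x)%:E)%E.
Proof.
move=> k0 mk nuk phi0 mphi.
pose b (x y : R) := (0 <= y) && (y < phi x).
have layer x : (\int[leb]_y (if b x y then 1 else 0)%:E = (phi x)%:E)%E.
  transitivity (\int[leb]_(y in `[0%R, phi x[) (cst 1%E) y)%E.
    rewrite [RHS]integral_mkcond; apply: eq_integral => y _.
    by rewrite /patch mem_setE in_itv/= /b; case: ifP.
  rewrite integral_cst// mul1e [LHS](lebesgue_measure_itv `[0, phi x[)/= lte_fin.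
  have [x0|x0] := ltP 0 (phi x); first by rewrite sube0.
  by congr (_%:E); apply/le_anti; rewrite x0 phi0.
have mb : measurable_fun setT (fun z : mR * mR => b z.1 z.2).
  apply: measurable_and; first by apply: measurable_fun_ler.
  by apply: measurable_fun_ltr => //; exact: (measurableT_comp mphi).
transitivity (\int[nu]_x \int[leb]_y (if b x y then 1 else 0)%:E)%E.
  by apply: eq_integral => x _; rewrite layer.
transitivity (\int[leb]_y \int[nu]_x (if b x y then 1 else 0)%:E)%E.
  apply: (@fubini_tonelli _ _ _ _ _ nu leb
    (fun z : mR * mR => (if b z.1 z.2 then 1 else 0)%:E)).
    by apply/measurable_EFinP; exact: measurable_fun_ifT.
  by move=> z; case: ifP; rewrite lee_fin.
transitivity (\int[leb]_y \int[leb]_x (if b x y then k x else 0)%:E)%E.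
  apply: eq_integral => y _.
  have mA : measurable [set x : mR | b x y].
    have /(_ measurableT [set true] I) : measurable_fun setT (fun x : mR => b x y).
      by apply: measurable_and => //; apply: measurable_fun_ltr.
    by rewrite setTI; congr measurable; apply/seteqP; split.
  transitivity (\int[nu]_(x in [set x : mR | b x y]) (cst 1%E) x)%E.
    rewrite [RHS]integral_mkcond; apply: eq_integral => x _.
    by rewrite /patch; case: ifPn => bx; [rewrite mem_set|rewrite memNset//; exact/negP].
  rewrite integral_cst// mul1e [LHS](nuk _ mA) integral_mkcond; apply: eq_integral => x _.
  by rewrite /patch; case: (boolP (b x y)) => bx; [rewrite mem_set|rewrite memNset//; exact/negP].
transitivity (\int[leb]_x \int[leb]_y (if b x y then k x else 0)%:E)%E.
  apply/esym; apply: (@fubini_tonelli _ _ _ _ _ leb leb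
    (fun z : mR * mR => (if b z.1 z.2 then k z.1 else 0)%:E)).
    apply/measurable_EFinP; apply: measurable_fun_ifT => //.
    exact: (measurableT_comp mk).
  by move=> z; case: ifP; rewrite lee_fin.
apply: eq_integral => x _; rewrite mulrC EFinM -layer -ge0_integralZl//; last 3 first.
- apply/measurable_EFinP; apply: measurable_fun_ifT => //.
  exact: (measurableT_comp mb (pair1_measurable x)).
- by move=> y _; case: ifP; rewrite lee_fin.
- by rewrite lee_fin.
by apply: eq_integral => y _; case: ifP; rewrite -EFinM ?mulr1 ?mulr0.
Qed.

Section density_measure.
Variables (k : mR -> R) (k0 : forall x, 0 <= k x) (mk : measurable_fun setT k).

(** The two proofs are arguments so that the measure structure, which depends on them, can be
    inferred from the term. *)
Definition density_measure of (forall x, 0 <= k x) & measurable_fun setT k :=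
  fun A : set mR => (\int[leb]_(x in A) (k x)%:E)%E.

Lemma density0 : density_measure k0 mk set0 = 0%E.
Proof. by rewrite /density_measure integral_set0. Qed.

Let density_ge0 A : (0 <= density_measure k0 mk A)%E.
Proof. by apply: integral_ge0 => x _; rewrite lee_fin. Qed.

Let density_sigma_additive : semi_sigma_additive (density_measure k0 mk).
Proof.
apply: semi_sigma_additive_nng_induced; first exact/measurable_EFinP.
by move=> x; rewrite lee_fin.
Qed.

HB.instance Definition _ := isMeasure.Build _ _ _ (density_measure k0 mk)
  density0 density_ge0 density_sigma_additive.

End density_measure.

Variables (G : cumulativeBounded (0 : R) (1 : R)) (mu : {posnum R}).
Hypothesis G_nneg : forall x : R, x < 0 -> G x = 0.
Hypothesis G_cont : continuous G.
Local Notation nu := (lebesgue_stieltjes_measure G).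
Local Notation nue := (lebesgue_stieltjes_measure (Ge mu G)).

Let kGe (y : mR) : R := if 0 <= y then mu%:num * (1 - G y) else 0.

Let G_le1 t : G t <= 1.
Proof. exact: cdf_le1. Qed.

Let G_ge0 t : 0 <= G t. Proof. exact: cdf_ge0. Qed.

Let mG : measurable_fun setT (G : R -> R).
Proof. exact: continuous_measurable_fun. Qed.

Let kGe0 y : 0 <= kGe y.
Proof.
by rewrite /kGe; case: ifP => // _; rewrite mulr_ge0// subr_ge0 G_le1.
Qed.

Let mkGe : measurable_fun setT kGe.
Proof.
apply: measurable_fun_ifT => //; first by apply: measurable_fun_ler.
by apply: measurable_funM => //; apply: measurable_funB.
Qed.

(** A Lebesgue-Stieltjes measure is determined by half-open intervals, where the claim is additivity
    of the integral defining [Ge]. *)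
Lemma equilibrium_densityE A : measurable A -> nue A = (\int[leb]_(x in A) (kGe x)%:E)%E.
Proof.
move=> mA; rewrite -[RHS]/(density_measure kGe0 mkGe A).
apply: lebesgue_stieltjes_measure_unique => // _ [[a b]] _ <-/=.
rewrite /lebesgue_stieltjes_measure /measure_extension/=.
rewrite measurable_mu_extE/=; last exact: is_ocitv.
have [ab|ba] := leP a b; last first.
  have -> : `]a, b]%classic = set0 :> set R.
    by rewrite set_itv_ge// bnd_simp -leNgt ltW.
  by rewrite wlength0 [RHS]density0.
rewrite wlength_itv_bnd// /density_measure.
have ik c d : leb.-integrable `[c, d] (EFin \o kGe).
  apply: (@integrable_of_bound _ _ _ _ _ _ mu%:num) => //.
  - exact: lebesgue_itv_lty.
  - exact: measurable_funTS.
  - move=> y _; rewrite ger0_norm// /kGe; case: ifP => // _.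
    by rewrite ler_piMr// gerBl.
(* A common base point to the left of both [a] and 0: as [kGe] vanishes on negative numbers,
   integrals from [c] still compute [Ge]. *)
pose c := Num.min a 0.
have ca : c <= a by rewrite /c ge_min lexx.
have c0 : c <= 0 by rewrite /c ge_min lexx orbT.
have GeE t : Ge mu G t = \int[leb]_(y in `[c, t]) kGe y.
  rewrite /Ge -RintegralZl//; last first.
    apply: (@integrable_of_bound _ _ _ _ _ _ 1) => //.
    - exact: lebesgue_itv_lty.
    - by apply: measurable_funTS; apply: measurable_funB.
    - by move=> y _; rewrite ger0_norm ?subr_ge0 ?G_le1// gerBl.
  rewrite Rintegral_mkcond [RHS]Rintegral_mkcond; congr (Rintegral _ _ _).
  apply/funext => y; rewrite /patch !mem_setE !in_itv/= /kGe.
  have [y0|y0] /= := leP 0 y; last by case: ifP.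
  by rewrite (le_trans c0 y0).
rewrite !GeE (@Rintegral_itvB _ kGe (BLeft c) (BRight b))// /Rintegral fineK//.
apply: integrable_fin_num => //.
apply: integrableS (ik c b) => // x /=; rewrite !in_itv/= => /andP[ax ->].
by rewrite (le_trans ca (ltW ax)).
Qed.

Variables (h : R -> R) (t : R).
Hypothesis h0 : forall x, 0 <= h x.
Hypothesis mh : measurable_fun setT h.
Hypothesis ih : forall b, leb.-integrable `[0, b] (EFin \o h).

Let B r := \int[leb]_(u in `[0, r]) h u.

Let mhr : measurable_fun setT (fun s : mR => h (t - s)).
Proof. by apply: (measurableT_comp mh); apply: measurable_funB. Qed.

Lemma equilibrium_reflect : (\int[nue]_(s in `[0%R, t]) (h (t - s)%R)%:E =
  \int[leb]_(s in `[0%R, t]) (mu%:num * (h (t - s) * (1 - G s)))%:E)%E.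
Proof.
rewrite integral_mkcond [RHS]integral_mkcond.
have -> : (fun s => (h (t - s))%:E) \_ `[0%R, t] =
    (fun s => (if 0 <= s <= t then h (t - s) else 0)%:E).
  by apply/funext => s; rewrite /patch mem_setE in_itv/=; case: ifP.
rewrite (@ge0_integral_density nue kGe).
- apply: eq_integral => s _; rewrite /patch mem_setE in_itv/= /kGe.
  have [s0|s0] /= := leP 0 s; last by rewrite mul0r.
  by case: ifP => _; rewrite ?mul0r//; congr (_%:E); ring.
- exact: kGe0.
- exact: mkGe.
- exact: equilibrium_densityE.
- by move=> s; case: ifP.
- apply: measurable_fun_ifT => //; apply: measurable_and; exact: measurable_fun_ler.
Qed.

Let ihr a b : 0 <= t - b -> leb.-integrable `[a, b] (EFin \o (fun s => h (t - s))).
Proof.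
move=> tb; apply/integrableP; split.
  by apply/measurable_EFinP; exact: measurable_funTS.
under eq_integral do rewrite /= ger0_norm//.
rewrite ge0_integral_reflect_itv//.
have : leb.-integrable `[t - b, t - a] (EFin \o h).
  exact: (itv_subset_integrable tb (lexx (t - a))).
move=> /integrableP[_]; under eq_integral do rewrite /= ger0_norm//.
by [].
Qed.

Let ihrG : leb.-integrable `[0, t] (EFin \o (fun s => h (t - s) * G s)).
Proof.
have tt : 0 <= t - t by rewrite subrr.
apply: le_integrable (ihr 0 tt) => //.
  by apply/measurable_EFinP; apply: measurable_funTS; exact: measurable_funM.
move=> s _ /=; rewrite lee_fin normrM ler_piMr// ger0_norm ?G_ge0//; exact: G_le1.
Qed.

Let ihrGc : leb.-integrable `[0, t] (EFin \o (fun s => h (t - s) * (1 - G s))).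
Proof.
have tt : 0 <= t - t by rewrite subrr.
have : leb.-integrable `[0, t] (EFin \o (fun s => h (t - s) - h (t - s) * G s)).
  by apply: integrable_sub => //; exact: ihr.
by apply: eq_integrable => // s _ /=; rewrite mulrBr mulr1.
Qed.

Lemma equilibrium_integrable : nue.-integrable `[0, t] (EFin \o (fun s => h (t - s))).
Proof.
apply/integrableP; split; first by apply/measurable_EFinP; exact: measurable_funTS.
under eq_integral do rewrite /= ger0_norm//.
rewrite equilibrium_reflect.
have : leb.-integrable `[0, t] (EFin \o (fun s => mu%:num * (h (t - s) * (1 - G s)))).
  exact: integrable_scale.
move=> /integrableP[_]; apply: le_lt_trans; apply: ge0_le_integral => //.
- by move=> s _; rewrite lee_fin !mulr_ge0// subr_ge0 G_le1.
- apply/measurable_EFinP; apply: measurable_funTS; apply: measurable_funM => //.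
  by apply: measurable_funM => //; apply: measurable_funB.
- apply: measurableT_comp => //; apply/measurable_EFinP; apply: measurable_funTS.
  by apply: measurable_funM => //; apply: measurable_funM => //; apply: measurable_funB.
- by move=> s _ /=; rewrite lee_fin ler_norm.
Qed.

(** Write [G s] as the mass of [[0, s]] and exchange integrals over the triangle [0 <= r <= s <= t];
    the inner integral over [[r, t]] reflects to [B (t - r)]. *)
Lemma cdf_convolution : \int[leb]_(s in `[0, t]) (h (t - s) * G s) = delay G B t.
Proof.
pose b (s r : R) := [&& 0 <= r, r <= s & s <= t].
have mb : measurable_fun setT (fun z : mR * mR => b z.1 z.2).
  apply: measurable_and; first by apply: measurable_fun_ler.
  by apply: measurable_and; apply: measurable_fun_ler.
rewrite /delay /Rintegral; congr fine.
transitivity (\int[leb]_s \int[nu]_r (if b s r then h (t - s) else 0)%:E)%E.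
  rewrite integral_mkcond; apply: eq_integral => s _.
  rewrite /patch mem_setE in_itv/=.
  have [/andP[s0 st]|st] := boolP (0 <= s <= t); last first.
    rewrite integral0_eq// => r _; rewrite /b; case: ifP => // /and3P[r0 rs st'].
    by move: st; rewrite (le_trans r0 rs) st'.
  transitivity (\int[nu]_(r in `[0%R, s]) (cst (h (t - s))%:E) r)%E; last first.
    rewrite integral_mkcond; apply: eq_integral => r _.
    by rewrite /patch mem_setE in_itv/= /b st andbT; case: ifP.
  by rewrite integral_cst// EFinM -(nu_itv0 G_nneg G_cont).
transitivity (\int[nu]_r \int[leb]_s (if b s r then h (t - s) else 0)%:E)%E.
  apply: (@fubini_tonelli _ _ _ _ _ leb nu
    (fun z : mR * mR => (if b z.1 z.2 then h (t - z.1) else 0)%:E)).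
    apply/measurable_EFinP; apply: measurable_fun_ifT => //.
    exact: (measurableT_comp mhr).
  by move=> z; case: ifP; rewrite lee_fin.
rewrite [RHS]integral_mkcond; apply: eq_integral => r _.
rewrite /patch mem_setE in_itv/=.
have [/andP[r0 rt]|rt] := boolP (0 <= r <= t); last first.
  rewrite integral0_eq// => s _; rewrite /b; case: ifP => // /and3P[r0 rs st'].
  by move: rt; rewrite r0 (le_trans rs st').
transitivity (\int[leb]_(s in `[r, t]) (h (t - s))%:E)%E.
  rewrite [RHS]integral_mkcond; apply: eq_integral => s _.
  by rewrite /patch mem_setE in_itv/= /b r0/=; case: ifP.
rewrite ge0_integral_reflect_itv// subrr /B /Rintegral fineK//.
exact: integrable_fin_num.
Qed.

(** The density of [Ge] turns the left side into the integral of [h (t - s) * (1 - G s)], whose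
    second part is [cdf_convolution]. The merely integrable [h] thereby enters only through its
    continuous primitive [B]. *)
Lemma equilibrium_integral : 0 <= t ->
  (mu%:num)^-1 * \int[nue]_(s in `[0, t]) h (t - s) = B t - delay G B t.
Proof.
move=> t0.
have tt : 0 <= t - t by rewrite subrr.
have -> : \int[nue]_(s in `[0, t]) h (t - s) =
    \int[leb]_(s in `[0, t]) (mu%:num * (h (t - s) * (1 - G s))).
  by rewrite /Rintegral equilibrium_reflect.
rewrite RintegralZl// mulrA mulVf ?gt_eqF// mul1r -cdf_convolution.
have -> : B t = \int[leb]_(s in `[0, t]) h (t - s).
  by rewrite /B /Rintegral ge0_integral_reflect_itv// subrr subr0.
rewrite -RintegralB//; last exact: ihr.
by apply: eq_Rintegral => s _; rewrite mulrBr mulr1.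
Qed.

End density.

(** * The fluid equation *)

Section lipschitz_cdf.
Variables (R : realType) (F : cumulativeBounded (0 : R) (1 : R)) (L : R).
Hypothesis FL : forall x y, `|F x - F y| <= L * `|x - y|.

Lemma lipschitz_cdf_ge0 : 0 <= L.
Proof. by have := FL 1 0; rewrite subr0 normr1 mulr1; apply: le_trans. Qed.

Lemma lipschitz_cdf_continuous : continuous F.
Proof.
move=> x; apply/cvgrPdist_lt => e e0.
have L1 : 0 < L + 1 by have := lipschitz_cdf_ge0; lra.
near=> y; apply: (le_lt_trans (FL x y)).
have : `|x - y| < e / (L + 1).
  by near: y; apply: cvgr_dist_lt => //; rewrite divr_gt0.
rewrite ltr_pdivlMr// mulrC => h; apply: le_lt_trans h.
by rewrite ler_wpM2r// lerDl.
Unshelve. all: by end_near. Qed.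

Lemma derive1_lipschitz_cdf x : 0 <= derive1 F x <= L.
Proof.
apply: derive1_bounds; first by rewrite lexx lipschitz_cdf_ge0.
move=> h h0.
have key : 0 <= h^-1 * (F (h + x) - F x).
  have [hp|hn] := ltP 0 h.
    rewrite mulr_ge0// ?invr_ge0 ?(ltW hp)// subr_ge0.
    by apply: (cumulative_is_nondecreasing F); rewrite lerDr ltW.
  rewrite mulr_le0// ?invr_le0// subr_le0.
  by apply: (cumulative_is_nondecreasing F); rewrite gerDr.
rewrite key/= -[leLHS]ger0_norm// normrM normfV.
rewrite ler_pdivrMl ?normr_gt0// mulrC.
by have := FL (h + x) x; rewrite addrK.
Qed.

(** Having reached its maximum, the nondecreasing [F] is constant to the right of [x], so right
    difference quotients vanish; without a derivative the default value is 0. *)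
Lemma derive1_cdf_sat x : (forall y, F y <= 1) -> F x = 1 -> derive1 F x = 0.
Proof.
move=> F1 Fx.
have [cx|dx] := pselect (cvg (h^-1 * (F (h + x) - F x) @[h --> 0^'])); last exact: derive1_dvg.
have h : h^-1 * (F (h + x) - F x) @[h --> 0^'+] --> derive1 F x.
  by apply: cvg_dnbhs_at_right; exact: derive1_cvg.
rewrite -(cvg_lim _ h)//; apply: cvg_lim => //.
apply: (@cvg_trans _ ((cst 0 : R -> R) z @[z --> (0 : R)^'+])); last exact: cvg_cst.
apply: near_eq_cvg; near=> z.
have z0 : 0 < z by [].
suff -> : F (z + x) = F x by rewrite subrr mulr0.
have : F x <= F (z + x) by apply: (cumulative_is_nondecreasing F); rewrite lerDr ltW.
by have := F1 (z + x); lra.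
Unshelve. all: by end_near. Qed.

End lipschitz_cdf.

(** The intervals [J n] shrink to the point [t], so their mass tends to 0, and two tails starting
    close to [t] differ by the mass of a subset of some [J N]. *)
Lemma atomless_tail_continuous (R : realType)
    (Z : {finite_measure set (measurableTypeR R) -> \bar R}) :
  (forall x, Z [set x] = 0%E) -> continuous (fun t => fine (Z `]t, +oo[%classic)).
Proof.
move=> Z0 t; apply/cvgrPdist_lt => e e0.
pose J n := `]t - n.+1%:R^-1, t + n.+1%:R^-1]%classic : set R.
have mI n : measurable (J n) by exact: measurable_itv.
have IE : \bigcap_n J n = [set t].
  apply/seteqP; split => [x hx|x -> n _]; last first.
    by rewrite /J /= in_itv/= ltrBlDr ltrDl lerDl invr_gt0 invr_ge0 ltr0Sn ler0n.
  apply/eqP; rewrite eq_sym -subr_eq0 -normr_le0 leNgt; apply/negP => tx.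
  have [N _ hN] := near_infty_natSinv_lt (PosNum tx).
  have := hN N (leqnn N); rewrite /= => h.
  have := hx N I; rewrite /J /= in_itv/= => /andP[h1 h2].
  have aux (a b c : R) : a - c < b -> b <= a + c -> `|a - b| <= c.
    by move=> ? ?; rewrite ler_norml; apply/andP; split; lra.
  have : `|t - x| <= N.+1%:R^-1 by exact: aux.
  by rewrite leNgt h.
have : Z (J n) @[n --> \oo] --> Z (\bigcap_n J n).
  apply: nonincreasing_cvg_mu => //.
  - by rewrite ltey_eq fin_num_measure//; exact: mI.
  - by rewrite IE.
  - move=> n m nm; apply/subsetPset => x; rewrite /J /= !in_itv/= => /andP[h1 h2].
    have : m.+1%:R^-1 <= n.+1%:R^-1 :> R by rewrite lef_pV2 ?posrE// ler_nat.
    have aux (a b c d : R) : a - c < b -> b <= a + c -> c <= d -> a - d < b <= a + d.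
      by move=> ? ? ?; apply/andP; split; lra.
    exact: aux.
rewrite IE Z0 => /fine_cvg/cvgrPdist_lt/(_ e e0)[N _ hN].
have {hN} := hN N (leqnn N); rewrite /= sub0r normrN => hN.
near=> s.
have ts : `|t - s| < N.+1%:R^-1.
  by near: s; apply: cvgr_dist_lt => //; rewrite invr_gt0.
have diff (a b : R) : a <= b -> t - N.+1%:R^-1 < a -> b <= t + N.+1%:R^-1 ->
    `|fine (Z `]a, +oo[%classic) - fine (Z `]b, +oo[%classic)| < e.
  move=> ab ta tb.
  have -> : fine (Z `]a, +oo[%classic) = fine (Z `]a, b]%classic) + fine (Z `]b, +oo[%classic).
    rewrite -fineD ?fin_num_measure//; congr fine.
    rewrite (@itv_bndbnd_setU _ _ (BRight a) (BRight b) +oo%O) ?bnd_simp//.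
    apply: measureU => //; rewrite -subset0 => x [] /=; rewrite !in_itv/= andbT.
    by move=> /andP[_ xb]; rewrite ltNge xb.
  rewrite addrK; apply: le_lt_trans hN.
  rewrite !ger0_norm ?fine_ge0// fine_le ?fin_num_measure//; first exact: mI.
  apply: (@le_measure _ _ _ Z); [by rewrite inE|by rewrite inE; exact: mI|].
  move=> x /=; rewrite !in_itv/= => /andP[h1 h2].
  by apply/andP; split; [exact: (lt_trans ta h1)|exact: (le_trans h2 tb)].
have N0 : 0 < N.+1%:R^-1 :> R by rewrite invr_gt0.
have aux (a b c : R) : 0 < c -> `|a - b| < c -> [/\ a - c < a, a - c < b, a <= a + c & b <= a + c].
  by move=> c0; rewrite ltr_norml => /andP[? ?]; split; lra.
have [a1 a2 a3 a4] := aux _ _ _ N0 ts.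
have [st|/ltW st] := leP t s; first exact: diff.
by rewrite distrC; exact: diff.
Unshelve. all: by end_near. Qed.

Section restriction.
Variables (R : realType) (F lambda : R -> R) (om : R).
Local Notation leb := (@lebesgue_measure R).
Hypothesis om_ge0 : 0 <= om.
Hypothesis lambda_ge0 : forall x : R, - om <= x -> 0 <= lambda x.
Hypothesis lambda_int : forall b, leb.-integrable `[- om, b] (EFin \o lambda).

(** Nothing is known of [lambda] to the left of [- om]; cutting it to 0 there gives a rate that is
    nonnegative and measurable on the whole line. *)
Let lam := lambda \_ `[- om, +oo[.

Let lamE x : - om <= x -> lam x = lambda x.
Proof. by move=> ox; rewrite /lam /patch mem_setE in_itv/= ox. Qed.

Lemma restricted_rate_ge0 x : 0 <= lam x.
Proof.
rewrite /lam /patch mem_setE in_itv/= andbT; case: ifP => // ox; exact: lambda_ge0.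
Qed.

Lemma restricted_rate_measurable : measurable_fun setT lam.
Proof.
apply/(measurable_restrictT _ (measurable_itv _)).
rewrite (_ : `[- om, +oo[%classic = \bigcup_n `[- om, n%:R]%classic).
  apply/measurable_fun_bigcup => [n|n]; first exact: measurable_itv.
  by have /integrableP[/measurable_EFinP] := lambda_int n%:R.
apply/seteqP; split => [x /=|x [n _] /=]; rewrite !in_itv/= ?andbT; last by case/andP.
move=> ox; exists (Num.bound `|x|) => //=; rewrite in_itv/= ox/=.
exact: (le_trans (ler_norm x) (ltW (archi_boundP (normr_ge0 x)))).
Qed.

Lemma restricted_rate_integrable a b : leb.-integrable `[a, b] (EFin \o lam).
Proof.
have -> : EFin \o lam = (EFin \o lambda) \_ `[- om, +oo[ by rewrite /lam restrict_EFin.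
apply/integrable_restrict => //.
apply: integrableS (lambda_int b) => //; first exact: measurableI.
by move=> x /= []; rewrite !in_itv/= andbT => /andP[_ ->] ->.
Qed.

(** Only values [lambda (u - s)] with [s <= u + om] enter, because the inverse never exceeds
    [u + om], its default value 0 on an empty set included. *)
Lemma H_restricted (u y : R) : 0 <= u -> H F lambda om u y = H F lam om u y.
Proof.
move=> u0.
have FdE (x : R) : x <= u + om -> Fd F lambda u x = Fd F lam u x.
  move=> xu; apply: eq_Rintegral => s; rewrite mem_setE in_itv/= => /andP[_ sx].
  by rewrite lamE//; lra.
have FtE (x : R) : x <= u + om -> Ft F lambda u x = Ft F lam u x.
  move=> xu; apply: eq_Rintegral => s; rewrite mem_setE in_itv/= => /andP[_ sx].
  by rewrite lamE//; lra.
have NFE : NF F lambda om u = NF F lam om u by exact: FdE.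
have FdinvE z : Fdinv F lambda om u z = Fdinv F lam om u z.
  congr inf; apply/seteqP; split => x [/andP[x0 xu] zx]; split; rewrite ?x0 ?xu//.
    by rewrite -FdE.
  by rewrite FdE.
have Fdinv_le z : Fdinv F lam om u z <= u + om.
  rewrite /Fdinv; set S := [set x | _].
  have [->|/set0P[x Sx]] := eqVneq S set0; first by rewrite inf0 addr_ge0.
  have [/andP[_ xu] _] := Sx; apply: le_trans xu.
  by apply: ge_inf => //; exists 0 => z' [/andP[]].
have lu : lam u = lambda u by apply: lamE; rewrite (le_trans _ u0)// oppr_le0.
by rewrite /H NFE !FdinvE !FtE// lu.
Qed.

End restriction.

Lemma continuous_extension (R : realType) (Y : R -> R) :
  {within `[0, +oo[, continuous Y} -> continuous (fun t : R => Y (Num.max t 0)).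
Proof.
move=> /continuous_within_itvcyP[cY Y0] t.
have [t0|t0] := ltP 0 t.
  have -> : (fun t : R => Y (Num.max t 0)) = Y \o (fun t : R => Num.max t 0) by [].
  apply: continuous_comp; first by apply: continuous_maxl => s; exact: cvg_id.
  by rewrite max_l ?ltW//; apply: cY; rewrite in_itv/= t0.
apply/cvgrPdist_lt => e e0; rewrite max_r//.
have /cvgrPdist_lt/(_ e e0)[/= d d0 hd] := Y0.
near=> s; have [s0|s0] := ltP 0 s; last by rewrite subrr normr0.
apply: hd => //=; rewrite sub0r normrN gtr0_norm//.
have : `|t - s| < d by near: s; exact: cvgr_dist_lt.
by rewrite ltr_norml => /andP[h1 _]; lra.
Unshelve. all: by end_near. Qed.

(** * Existence and uniqueness for the fluid equation *)

Section fluid_equation.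
Variables (R : realType) (F G : cumulativeBounded (0 : R) (1 : R)).
Variables (mu : {posnum R}) (om L Q0 : R) (lambda : R -> R).
Variable Z0 : {finite_measure set (measurableTypeR R) -> \bar R}.
Local Notation leb := (@lebesgue_measure R).
Local Notation nue := (lebesgue_stieltjes_measure (Ge mu G)).
Hypothesis F_nneg : forall x : R, x < 0 -> F x = 0.
Hypothesis G_nneg : forall x : R, x < 0 -> G x = 0.
Hypothesis F_lip : forall x y, `|F x - F y| <= L * `|x - y|.
Hypothesis G_cont : continuous G.
Hypothesis om_ge0 : 0 <= om.
Hypothesis lambda_ge0 : forall x : R, - om <= x -> 0 <= lambda x.
Hypothesis lambda_int : forall b, leb.-integrable `[- om, b] (EFin \o lambda).
Hypothesis Z0_atomless : forall x, Z0 [set x] = 0%E.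

Let lam := lambda \_ `[- om, +oo[.
Let cF : continuous F. Proof. exact: lipschitz_cdf_continuous F_lip. Qed.
Let F01 x : 0 <= F x <= 1. Proof. by rewrite cdf_ge0 ?cdf_le1. Qed.
Let f_bound x : 0 <= derive1 F x <= L. Proof. exact: derive1_lipschitz_cdf. Qed.
Let f_sat x : F x = 1 -> derive1 F x = 0.
Proof. by apply: derive1_cdf_sat => y; exact: cdf_le1. Qed.
Let lam_ge0 x : 0 <= lam x. Proof. exact: restricted_rate_ge0. Qed.
Let mlam : measurable_fun setT lam. Proof. exact: restricted_rate_measurable. Qed.
Let ilam a b : leb.-integrable `[a, b] (EFin \o lam).
Proof. exact: restricted_rate_integrable. Qed.

Let A psi X t := memory F lam om psi X t.
Let Lam t := \int[leb]_(s in `[0, t]) lam s.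

Let cLam : continuous Lam. Proof. by apply: continuous_primitive => b; exact: ilam. Qed.

(** All that does not involve the solution: the initial content, and the contribution
    [Lam - dG * Lam] of the summand [lambda] of [H]. *)
Let w t := fine (Z0 `]t, +oo[%classic) + Q0 * (1 - G t) + Lam t - delay G Lam t.

Let cw : continuous w.
Proof.
move=> t; apply: cvgB; last exact: (delay_continuous G_nneg G_cont cLam).
apply: cvgD; last exact: cLam.
apply: cvgD; first exact: (atomless_tail_continuous Z0_atomless).
by apply: cvgM; [exact: cvg_cst|apply: cvgB; [exact: cvg_cst|exact: G_cont]].
Qed.

Let cA psi X : smoothing psi -> continuous X -> continuous (A psi X).
Proof. by move=> sp cX; apply: (@memory_continuous _ F lam om L). Qed.

Let sstep := smoothing_step R.

(** By [H_kern] the integrand splits into arrival rate minus kernel, and [equilibrium_integral]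
    treats each part. The delayed memory then merges with the delayed excess. *)
Let fluid_rhs (X : R -> R) (t : R) : continuous X -> 0 <= t ->
  fine (Z0 `]t, +oo[%classic) + Q0 * (1 - G t)
  + (mu%:num)^-1 * \int[nue]_(s in `[0, t])
      H F lambda om (t - s) (Num.max (X (t - s) - 1) 0)
  + \int[lebesgue_stieltjes_measure G]_(s in `[0, t]) Num.max (X (t - s) - 1) 0 =
  w t - A step X t + delay G (fun u => excess (X u) + A step X u) t.
Proof.
move=> cX t0.
pose kap u := kern F lam om step u (excess (X u)).
have kap0 u : 0 <= kap u.
  by have /andP[] := @kern_bounds _ F lam om L cF F01 f_bound lam_ge0 mlam ilam
    step u (excess (X u)) u sstep (lexx u).
have mkap : measurable_fun setT kap.
  apply: (@kern_measurable _ F lam om L) => //.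
  by apply: continuous_measurable_fun; exact: continuous_excess.
have ikap b : leb.-integrable `[0, b] (EFin \o kap).
  exact: (@memory_integrable _ F lam om L).
have HE : \int[nue]_(s in `[0, t]) H F lambda om (t - s) (Num.max (X (t - s) - 1) 0) =
    \int[nue]_(s in `[0, t]) lam (t - s) - \int[nue]_(s in `[0, t]) kap (t - s).
  rewrite -RintegralB//; last 2 first.
  - by apply: equilibrium_integrable => // b; exact: ilam.
  - exact: equilibrium_integrable.
  apply: eq_Rintegral => s; rewrite mem_setE in_itv/= => /andP[s0 st].
  rewrite H_restricted//; last by rewrite subr_ge0.
  rewrite (@H_kern _ F lam om)//.
  by rewrite addr_ge0// subr_ge0.
have ilam0 b : leb.-integrable `[0, b] (EFin \o lam) by exact: ilam.
have El : (mu%:num)^-1 * \int[nue]_(s in `[0, t]) lam (t - s) = Lam t - delay G Lam t.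
  exact: equilibrium_integral.
have Ek : (mu%:num)^-1 * \int[nue]_(s in `[0, t]) kap (t - s) = A step X t - delay G (A step X) t.
  exact: equilibrium_integral.
rewrite HE (mulrBr (mu%:num)^-1) El Ek.
have cq : continuous (fun u => excess (X u)) by exact: continuous_excess.
have cAX : continuous (A step X) by exact: cA.
have -> : \int[lebesgue_stieltjes_measure G]_(s in `[0, t]) Num.max (X (t - s) - 1) 0 =
    delay G (fun u => excess (X u) + A step X u) t - delay G (A step X) t.
  rewrite -delayB//; last by move=> u; apply: cvgD; [exact: cq|exact: cAX].
  by apply: eq_Rintegral => s _; rewrite addrK.
by rewrite /w -/(Lam t) -/(A step X t) -/(A step X) -/Lam; ring.
Qed.

Lemma fluid_solution_volterra (X : R -> R) : continuous X ->
  fluid_solution F G mu lambda om Q0 Z0 X <->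
  forall t, 0 <= t -> X t = w t - A step X t + delay G (fun u => excess (X u) + A step X u) t.
Proof. by move=> cX; split => h t t0; rewrite h// fluid_rhs. Qed.

Let dG : delay_operator (delay G).
Proof. exact: delay_delay_operator. Qed.

Lemma fluid_existence : exists2 X : R -> R, continuous X &
  fluid_solution F G mu lambda om Q0 Z0 X.
Proof.
have [X cX hX] : exists2 X : R -> R, continuous X & forall t, 0 <= t ->
    X t = w t - A step X t + delay G (fun u => excess (X u) + A step X u) t.
  apply: (@volterra_existence _ _ w (A step) (fun n => A (ramp n))) => //.
  - by move=> X cX; exact: cA.
  - by move=> n X cX; apply: cA => //; exact: smoothing_ramp.
  - by move=> n X; exact: memory0.
  - move=> n; apply: (@memory_lipschitz _ F lam om L _ _ _ _ _ _ _ n.+1%:R) => //.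
      exact: smoothing_ramp.
    exact: ramp_lip.
  - move=> T n m X1 X2 nm cX1 cX2.
    have ramp01 k (x : R) : 0 <= ramp k x <= 1 by have [_ ->] := smoothing_ramp R k.
    (* For [x > 0] the argument [y] lies beyond the rise of [ramp l], whose value there is 1. The
       index [k] is free, so both order conditions follow. *)
    have rampP (k l : nat) (x y : R) : (n <= l)%N -> x + n.+1%:R^-1 <= y ->
        ramp k x <= ramp l y.
      move=> nl xy; have [x0|x0] := leP x 0.
        by rewrite (ramp_le0 k x0); have /andP[] := ramp01 l y.
      rewrite (@ramp_eq1 _ l); first by have /andP[] := ramp01 k x.
      apply: (@le_trans _ _ n.+1%:R^-1); first by rewrite lef_pV2 ?posrE// ler_nat.
      by apply: le_trans xy; rewrite lerDr ltW.
    have sr k := smoothing_ramp R k.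
    split; apply: (@memory_order _ F lam om L) => //.
    + exact: ramp_le0.
    + by move=> x y; exact: rampP.
    + exact: ramp_le0.
    + by move=> x y; exact: rampP.
  - move=> Xn X cXn cX XnX T T0.
    apply: (@memory_cvg _ F lam om L) => //; first exact: smoothing_ramp.
    by move=> y_ y v; exact: ramp_cvg.
exists X => //; exact/fluid_solution_volterra.
Qed.

(** Both solutions use the same monotone [step], so the order conditions hold with [rho = 0] and
    stability bounds the difference by 0. *)
Lemma fluid_uniqueness (X Y : R -> R) (t : R) : continuous X -> continuous Y ->
  fluid_solution F G mu lambda om Q0 Z0 X ->
  fluid_solution F G mu lambda om Q0 Z0 Y -> 0 <= t -> Y t = X t.
Proof.
move=> cX cY /(fluid_solution_volterra cX) sX /(fluid_solution_volterra cY) sY t0.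
have [K K0 hK] := volterra_stability dG t0.
have step_le (x y : R) : x + 0 <= y -> step x <= step y.
  rewrite addr0 => xy; rewrite /step; case: ifPn => x0; last by case: ifP.
  by rewrite ifT// (lt_le_trans x0 xy).
have ord (X1 X2 : R -> R) : continuous X1 -> continuous X2 ->
    order_cond t 0 X1 X2 (A step X1) (A step X2).
  by move=> cX1 cX2; apply: (@memory_order _ F lam om L) => //; exact: step_le0.
have := hK w 0 Y X (A step Y) (A step X) (lexx 0) cY cX (cA sstep cY) (cA sstep cX).
rewrite /A !memory0 mulr0 => /(_ erefl) h.
apply/eqP; rewrite -subr_eq0 -normr_le0; apply: h => //.
- by move=> u /andP[u0 _]; exact: sY.
- by move=> u /andP[u0 _]; exact: sX.
- exact: ord.
- exact: ord.
- by rewrite t0 lexx.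
Qed.

End fluid_equation.

Lemma fluid_solution_ext (R : realType) (F : R -> R)
    (G : cumulativeBounded (0 : R) (1 : R)) (mu : {posnum R}) (lambda : R -> R)
    (om Q0 : R) (Z0 : {finite_measure set (measurableTypeR R) -> \bar R})
    (X Y : R -> R) : (forall t, 0 <= t -> Y t = X t) ->
  fluid_solution F G mu lambda om Q0 Z0 X -> fluid_solution F G mu lambda om Q0 Z0 Y.
Proof.
move=> YX sX t t0; rewrite (YX _ t0) (sX _ t0).
have YXs s : s \in `[0, t]%classic -> Y (t - s) = X (t - s).
  by rewrite mem_setE in_itv/= => /andP[_ st]; rewrite YX// subr_ge0.
have eH : \int[lebesgue_stieltjes_measure (Ge mu G)]_(s in `[0, t])
      H F lambda om (t - s) (Num.max (X (t - s) - 1) 0) =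
    \int[lebesgue_stieltjes_measure (Ge mu G)]_(s in `[0, t])
      H F lambda om (t - s) (Num.max (Y (t - s) - 1) 0).
  by apply: eq_Rintegral => s /YXs ->.
have eG : \int[lebesgue_stieltjes_measure G]_(s in `[0, t]) Num.max (X (t - s) - 1) 0 =
    \int[lebesgue_stieltjes_measure G]_(s in `[0, t]) Num.max (Y (t - s) - 1) 0.
  by apply: eq_Rintegral => s /YXs ->.
by rewrite eH eG.
Qed.

Theorem proposition3p1 (R : realType)
  (F G : cumulativeBounded (0 : R) (1 : R))
  (F_nneg : forall x, x < 0 -> F x = 0)
  (G_nneg : forall x, x < 0 -> G x = 0)
  (F_lip : [lipschitz F x | x in [set: R]])
  (G_cont : continuous G)
  (mu : {posnum R})
  (G_mean : (\int[lebesgue_stieltjes_measure G]_x x%:E = ((mu%:num)^-1)%:E)%E)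
  (omega0 : R) (omega0_ge0 : 0 <= omega0)
  (lambda : R -> R)
  (lambda_ge0 : forall x, - omega0 <= x -> 0 <= lambda x)
  (lambda_int : forall b,
     lebesgue_measure.-integrable `[- omega0, b] (EFin \o lambda))
  (Z0 : {finite_measure set (measurableTypeR R) -> \bar R})
  (Z0_pos : Z0 `]-oo, 0]%classic = 0%E)
  (Z0_atomless : forall x, Z0 [set x] = 0%E)
  (Q0 Zb0 Xb0 : R)
  (Q0_def : Q0 = \int[lebesgue_measure]_(s in `[0, omega0])
                   ((1 - F s) * lambda (- s)))
  (omega0_def : omega0 = Fdinv F lambda omega0 0 Q0)
  (Zb0_def : Zb0 = fine (Z0 `]0, +oo[%classic))
  (Xb0_def : Xb0 = Q0 + Zb0)
  (Q0_nonidling : Q0 = Num.max (Xb0 - 1) 0)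
  (Zb0_nonidling : Zb0 = Num.min Xb0 1) :
  exists X : R -> R,
    ({within `[0, +oo[, continuous X}
       /\ fluid_solution F G mu lambda omega0 Q0 Z0 X)
    /\ (forall Y : R -> R,
          {within `[0, +oo[, continuous Y} ->
          fluid_solution F G mu lambda omega0 Q0 Z0 Y ->
          forall t, 0 <= t -> Y t = X t).

Proof.
have [L FL] : exists L : R, forall x y, `|F x - F y| <= L * `|x - y|.
  (* The Lipschitz property is stated for all constants beyond some [M], hence the choice
     [M + 1]. *)
  have [M [_ hM]] := F_lip; exists (M + 1) => x y.
  by apply: (hM (M + 1) _ (x, y)) => //; rewrite ltrDl.
have [X cX sX] := fluid_existence mu Q0 F_nneg G_nneg FL G_cont omega0_ge0
  lambda_ge0 lambda_int Z0_atomless.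
exists X; split; first by split => //; exact: continuous_subspaceT.
move=> Y cY sY t t0.
(* The competitor is only continuous on the half-line; this extension is continuous everywhere, and
   the equation sees only nonnegative times. *)
pose Y' u := Y (Num.max u 0).
have Y'E u : 0 <= u -> Y' u = Y u by move=> u0; rewrite /Y' max_l.
have cY' : continuous Y' by exact: continuous_extension.
have sY' : fluid_solution F G mu lambda omega0 Q0 Z0 Y'.
  exact: fluid_solution_ext Y'E sY.
rewrite -(Y'E _ t0).
exact: (fluid_uniqueness F_nneg G_nneg FL G_cont omega0_ge0 lambda_ge0 lambda_int cX cY' sX sY' t0).
Qed.
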